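(* Let $A=\bigwedge_{1\le i\le m}A_i$ where the $A_i$ are prenex formulas of $\mathbf{G}^\Delta$. Then one can construct, in time polynomial in the size of $A$, sets of order clauses $\mathrm{CS}_{sat}(A)$ and $\mathrm{CS}_{val}(A_i)$ for $1\le i\le m$ such that (a) $A$ is 1-satisfiable if and only if $\mathrm{CS}_{sat}(A)$ is DTOE-satisfiable, and (b) $\models A$ if and only if $\mathrm{CS}_{val}(A_i)$ is DTOE-unsatisfiable for each $i\in\{1,\dots,m\}$.
   Context: Formulas of first-order Gödel logic with $\Delta$ ($\mathbf{G}^\Delta$) are built from atoms $p(t_1,\dots,t_n)$ (no equality), $\bot,\top$, the connectives $\wedge,\vee,\to$, the unary operator $\Delta$ and quantifiers $\forall,\exists$. An interpretation $\mathcal I$ consists of a nonempty domain $D$ and a valuation assigning elements of $D$ to constants and variables, functions $D^n\to D$ to function symbols and functions $D^n\to[0,1]$ to predicate symbols. Truth values: atoms get the value of the predicate's function at the argument values; $v(\bot)=0$, $v(\top)=1$; $\wedge=\min$, $\vee=\max$; $v(A\to B)=1$ if $v(A)\le v(B)$ and $v(B)$ otherwise; $v(\Delta A)=1$ if $v(A)=1$ and $0$ otherwise; $v_{\mathcal I}(\forall xA)=\inf_{d\in D}v_{\mathcal I[d/x]}(A)$, $v_{\mathcal I}(\exists xA)=\sup_{d\in D}v_{\mathcal I[d/x]}(A)$. $\models A$ (valid): value $1$ in all interpretations; 1-satisfiable: value $1$ in some interpretation. A prenex formula is a closed formula $Q_1y_1\dots Q_ny_nP$ with $P$ quantifier free,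 $Q_i\in\{\forall,\exists\}$. Order clauses: terms are first-order terms over a signature in which atoms are regarded as terms (predicate symbols as function symbols) and $\bot,\top$ are constants; an order literal is $s<t$ or $s\le t$; an order clause is a finite set of order literals, read as their universally closed disjunction. A set of order clauses is DTOE-satisfiable if it has a classical model in which $<$ is a strict dense total order, $\le$ is its reflexive closure, $\bot\le x$ and $x\le\top$ for all $x$, and $\bot<\top$; otherwise it is DTOE-unsatisfiable. *)

(* Defs.v *)
From Stdlib Require List.
From mathcomp Require Import all_boot all_order all_algebra.
From mathcomp Require Import classical_sets reals.

Set Implicit Arguments.
Unset Strict Implicit.
Unset Printing Implicit Defensive.

Import Order.TTheory GRing.Theory Num.Theory.

(* Names of variables, functions and predicates are finite binary words, so
   that an expression has a definite length over a finite alphabet. *)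
Notation word := (seq bool).

(** * Syntax of first-order Goedel logic with Delta *)

(* A symbol is a name together with the number of arguments it is applied to
   (p/1 and p/2 are different symbols); constants are applied to [::]. *)
Inductive term :=
| TVar (x : word)
| TFun (f : word) (ts : seq term).

Inductive formula :=
| FAtom (p : word) (ts : seq term)
| FBot
| FTop
| FAnd (A B : formula)
| FOr (A B : formula)
| FImp (A B : formula)
| FDelta (A : formula)
| FAll (x : word) (A : formula)
| FEx (x : word) (A : formula).

Fixpoint term_vars (t : term) : seq word :=
  match t with
  | TVar x => [:: x]
  | TFun _ ts => flatten (map term_vars ts)
  end.

Fixpoint free_vars (A : formula) : seq word :=
  match A with
  | FAtom _ ts => flatten (map term_vars ts)
  | FBot | FTop => [::]
  | FAnd B C | FOr B C | FImp B C => free_vars B ++ free_vars C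
  | FDelta B => free_vars B
  | FAll x B | FEx x B => [seq y <- free_vars B | y != x]
  end.

Fixpoint quantifier_free (A : formula) : bool :=
  match A with
  | FAtom _ _ | FBot | FTop => true
  | FAnd B C | FOr B C | FImp B C => quantifier_free B && quantifier_free C
  | FDelta B => quantifier_free B
  | FAll _ _ | FEx _ _ => false
  end.

Fixpoint prenex_shape (A : formula) : bool :=
  match A with
  | FAll _ B | FEx _ B => prenex_shape B
  | _ => quantifier_free A
  end.

Definition prenex (A : formula) : bool :=
  prenex_shape A && (free_vars A == [::]).

(* A_1 /\ (A_2 /\ (... /\ A_m)); the empty conjunction is FTop. *)
Fixpoint big_and (As : seq formula) : formula :=
  match As with
  | [::] => FTop
  | [:: A] => A
  | A :: As' => FAnd A (big_and As')
  end.

Definition prenex_conjunction (A : formula) : Prop :=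
  exists2 As : seq formula, all prenex As & A = big_and As.

(** * Semantics over [0,1] *)

Section Semantics.
Variable R : realType.
Local Open Scope ring_scope.

(* On argument lists of length n, ifun f and ipred p are the functions
   dom^n -> dom and dom^n -> [0,1] interpreting f/n and p/n; dom is inhabited
   because of ivar. *)
Record interp := Interp {
  dom : Type;
  ivar : word -> dom;
  ifun : word -> seq dom -> dom;
  ipred : word -> seq dom -> R;
  ipred01 : forall p ds, 0 <= ipred p ds <= 1
}.

Definition interp_upd (I : interp) (x : word) (d : dom I) : interp :=
  Interp (fun y => if y == x then d else ivar I y) (@ifun I) (@ipred01 I).

Fixpoint term_val (I : interp) (t : term) : dom I :=
  match t with
  | TVar x => ivar I x
  | TFun f ts => ifun f (map (term_val I) ts)
  end.

Fixpoint formula_val (I : interp) (A : formula) {struct A} : R :=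
  match A with
  | FAtom p ts => ipred p (map (term_val I) ts)
  | FBot => 0
  | FTop => 1
  | FAnd B C => Num.min (formula_val I B) (formula_val I C)
  | FOr B C => Num.max (formula_val I B) (formula_val I C)
  | FImp B C =>
      if formula_val I B <= formula_val I C then 1 else formula_val I C
  | FDelta B => if formula_val I B == 1 then 1 else 0
  | FAll x B => inf (range (fun d : dom I => formula_val (interp_upd x d) B))
  | FEx x B => sup (range (fun d : dom I => formula_val (interp_upd x d) B))
  end.

Definition valid (A : formula) : Prop :=
  forall I : interp, formula_val I A = 1.

Definition one_satisfiable (A : formula) : Prop :=
  exists I : interp, formula_val I A = 1.

End Semantics.

(** * Order clauses *)

(* Atoms are terms: predicate symbols act as function symbols. The two kinds
   of names are kept apart, so a function and a predicate may share a name. *)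
Inductive osymbol :=
| OFun (f : word)
| OPred (p : word).

Inductive oterm :=
| OVar (x : word)
| OBot
| OTop
| OApp (s : osymbol) (ts : seq oterm).

Inductive oliteral :=
| OLt (s t : oterm)
| OLe (s t : oterm).

(* Finite sets are represented by lists; only membership matters below. *)
Definition oclause := seq oliteral.
Definition oclauses := seq oclause.

Record ostructure := OStructure {
  ocar : Type;
  oapp : osymbol -> seq ocar -> ocar;
  obot : ocar;
  otop : ocar;
  olt : ocar -> ocar -> Prop;
  ole : ocar -> ocar -> Prop
}.

Record dtoe_axioms (M : ostructure) : Prop := DtoeAxioms {
  olt_irrefl : forall x : ocar M, ~ olt x x;
  olt_trans : forall x y z : ocar M, olt x y -> olt y z -> olt x z;
  olt_total : forall x y : ocar M, [\/ olt x y, x = y | olt y x];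
  olt_dense : forall x y : ocar M, olt x y -> exists2 z, olt x z & olt z y;
  ole_refl_closure : forall x y : ocar M, ole x y <-> olt x y \/ x = y;
  obot_le : forall x : ocar M, ole (obot M) x;
  ole_top : forall x : ocar M, ole x (otop M);
  obot_lt_top : olt (obot M) (otop M)
}.

Fixpoint oterm_val (M : ostructure) (e : word -> ocar M) (t : oterm) : ocar M :=
  match t with
  | OVar x => e x
  | OBot => obot M
  | OTop => otop M
  | OApp s ts => oapp s (map (oterm_val e) ts)
  end.

Definition oliteral_true (M : ostructure) (e : word -> ocar M)
    (l : oliteral) : Prop :=
  match l with
  | OLt s t => olt (oterm_val e s) (oterm_val e t)
  | OLe s t => ole (oterm_val e s) (oterm_val e t)
  end.

Definition oclause_true (M : ostructure) (C : oclause) : Prop :=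
  forall e : word -> ocar M, List.Exists (oliteral_true e) C.

Definition dtoe_satisfiable (S : oclauses) : Prop :=
  exists M : ostructure, dtoe_axioms M /\ List.Forall (oclause_true M) S.

Definition dtoe_unsatisfiable (S : oclauses) : Prop := ~ dtoe_satisfiable S.

(** * Polynomial time *)

(* The machine model: first-order, call-by-value recursive programs on binary
   trees (the language F of N. D. Jones, Computability and Complexity). Each
   evaluation step is charged at least the size of the tree it produces, as if
   trees were copied and never shared. A run of cost c thus makes at most c
   steps on trees of size at most c + input size, so Turing machines simulate
   these programs with polynomial overhead; conversely a tape is a pair of
   lists, so the programs simulate Turing machines with polynomial overhead. *)

Inductive tree :=
| Nil
| Cons (l r : tree).

Fixpoint tree_size (t : tree) : nat :=
  match t with
  | Nil => 1
  | Cons l r => (tree_size l + tree_size r).+1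
  end.

(* Variables are de Bruijn indices. *)
Inductive expr :=
| EVar (i : nat)
| ENil
| ECons (l r : expr)
| ECase (e e_nil e_cons : expr)  (* e_cons sees the head as 0, the tail as 1 *)
| ECall (f : nat) (e : expr).    (* e is variable 0 of the body of f *)

(* The f-th entry is the body of the unary function f; function 0 is main. *)
Definition program := seq expr.

(* eval P env e v c: in the environment env, e evaluates to v with cost c. *)
Inductive eval (P : program) : seq tree -> expr -> tree -> nat -> Prop :=
| eval_var env i v :
    onth env i = Some v ->
    eval P env (EVar i) v (tree_size v)
| eval_nil env :
    eval P env ENil Nil 1
| eval_cons env el er l r cl cr :
    eval P env el l cl ->
    eval P env er r cr ->
    eval P env (ECons el er) (Cons l r) (cl + cr + tree_size (Cons l r))
| eval_case_nil env e e_nil e_cons v c c' :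
    eval P env e Nil c ->
    eval P env e_nil v c' ->
    eval P env (ECase e e_nil e_cons) v (c + c' + tree_size v)
| eval_case_cons env e e_nil e_cons l r v c c' :
    eval P env e (Cons l r) c ->
    eval P [:: l, r & env] e_cons v c' ->
    eval P env (ECase e e_nil e_cons) v (c + c' + tree_size v)
| eval_call env f e body u v c c' :
    eval P env e u c ->
    onth P f = Some body ->
    eval P [:: u] body v c' ->
    eval P env (ECall f e) v (c + c' + tree_size v).

(* A single program computes f (up to the encodings) on all inputs satisfying
   dom, within a polynomial in the size of the encoded input. Sizes are
   positive, so a * n ^ k dominates every polynomial in n. *)
Definition poly_time_on (A B : Type) (encA : A -> tree) (encB : B -> tree)
    (dom : A -> Prop) (f : A -> B) : Prop :=
  exists (P : program) (a k : nat), forall x : A, dom x ->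
    exists2 c : nat,
      eval P [:: encA x] (ECall 0 (EVar 0)) (encB (f x)) c &
      c <= a * tree_size (encA x) ^ k.

(** * Encodings of syntax as trees *)

Definition enc_list (ts : seq tree) : tree := foldr Cons Nil ts.

Definition enc_bool (b : bool) : tree := if b then Cons Nil Nil else Nil.

Definition enc_word (w : word) : tree := enc_list (map enc_bool w).

(* The n-th constructor of a data type, applied to the encoded arguments ts. *)
Definition enc_constr (n : nat) (ts : seq tree) : tree :=
  Cons (iter n (Cons Nil) Nil) (enc_list ts).

Fixpoint enc_term (t : term) : tree :=
  match t with
  | TVar x => enc_constr 0 [:: enc_word x]
  | TFun f ts => enc_constr 1 [:: enc_word f; enc_list (map enc_term ts)]
  end.

Fixpoint enc_formula (A : formula) : tree :=
  match A with
  | FAtom p ts => enc_constr 0 [:: enc_word p; enc_list (map enc_term ts)]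
  | FBot => enc_constr 1 [::]
  | FTop => enc_constr 2 [::]
  | FAnd B C => enc_constr 3 [:: enc_formula B; enc_formula C]
  | FOr B C => enc_constr 4 [:: enc_formula B; enc_formula C]
  | FImp B C => enc_constr 5 [:: enc_formula B; enc_formula C]
  | FDelta B => enc_constr 6 [:: enc_formula B]
  | FAll x B => enc_constr 7 [:: enc_word x; enc_formula B]
  | FEx x B => enc_constr 8 [:: enc_word x; enc_formula B]
  end.

Definition enc_osymbol (s : osymbol) : tree :=
  match s with
  | OFun f => enc_constr 0 [:: enc_word f]
  | OPred p => enc_constr 1 [:: enc_word p]
  end.

Fixpoint enc_oterm (t : oterm) : tree :=
  match t with
  | OVar x => enc_constr 0 [:: enc_word x]
  | OBot => enc_constr 1 [::]
  | OTop => enc_constr 2 [::]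
  | OApp s ts => enc_constr 3 [:: enc_osymbol s; enc_list (map enc_oterm ts)]
  end.

Definition enc_oliteral (l : oliteral) : tree :=
  match l with
  | OLt s t => enc_constr 0 [:: enc_oterm s; enc_oterm t]
  | OLe s t => enc_constr 1 [:: enc_oterm s; enc_oterm t]
  end.

Definition enc_oclause (C : oclause) : tree := enc_list (map enc_oliteral C).

Definition enc_oclauses (S : oclauses) : tree := enc_list (map enc_oclause S).

(* Main.v *)
Require Import Defs.
From mathcomp Require Import all_boot all_order all_algebra.
From mathcomp Require Import classical_sets reals.
From mathcomp Require Import boolp wochoice zify lra.
Import Defs.

(** Satisfiability: a conjunction A of prenex formulas has value 1 iff for every
u < 1 it has value greater than u. A supremum greater than u is witnessed by an
element, and an infimum is at least u as soon as all its terms are greater than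
u; so the existential quantifiers are replaced by Skolem functions that depend
on u and on the preceding universal variables, and the matrix P is required to
satisfy u < P for all u < top. Validity is treated dually: A has value less than
1 iff for some constant c < top the universal quantifiers can be Skolemized so
that P < c. The value of each subformula of P is named by a new function symbol,
defined by a few order clauses.

An interpretation gives a model whose order is [0,1] with a dense copy of the
domain inserted just above 0; Skolem and value symbols are interpreted by
walking down the formula along the path encoded in their name. Conversely, a
model gives an interpretation on the countable set of ground terms: countably
many elements x_0, x_1, ... of the order are embedded in [0,1] by mapping x to
the normalised sum of 2^-(i+1) over all i with x_i < x, and closing the ground
terms under a midpoint function makes the images of the elements below top
cofinal in [0,1).

For the time bound, the cost of evaluating an expression is linear in the size
of its environment and of the results of its calls, plus the cost of these
calls; hence every recursive function costs at most the size of its structural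
argument times a polynomial in a bound on all the trees involved. *)

Set Implicit Arguments.
Unset Strict Implicit.
Unset Printing Implicit Defensive.

(** * The translation *)

(** Arguments form a list nested inside [term]; the inner fixpoint supplies the induction hypothesis
    for each of its members. *)
Fixpoint term_nested_ind (P : term -> Prop) (Pvar : forall x, P (TVar x))
    (Pfun : forall f ts, List.Forall P ts -> P (TFun f ts)) (t : term) : P t :=
  match t with
  | TVar x => Pvar x
  | TFun f ts =>
      Pfun f ts ((fix all ts : List.Forall P ts :=
        match ts with
        | [::] => List.Forall_nil P
        | t :: ts' => List.Forall_cons t (term_nested_ind Pvar Pfun t) (all ts')
        end) ts)
  end.

Fixpoint oterm_nested_ind (P : oterm -> Prop)
    (Pvar : forall x, P (OVar x)) (Pbot : P OBot) (Ptop : P OTop)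
    (Papp : forall s ts, List.Forall P ts -> P (OApp s ts)) (t : oterm) : P t :=
  match t with
  | OVar x => Pvar x
  | OBot => Pbot
  | OTop => Ptop
  | OApp s ts =>
      Papp s ts ((fix all ts : List.Forall P ts :=
        match ts with
        | [::] => List.Forall_nil P
        | t :: ts' => List.Forall_cons t (oterm_nested_ind Pvar Pbot Ptop Papp t) (all ts')
        end) ts)
  end.

Lemma eq_map_Forall (T U : Type) (f g : T -> U) (s : seq T) :
  List.Forall (fun x => f x = g x) s -> map f s = map g s.
Proof. by elim=> //= x s' -> _ ->. Qed.

Notation osubst := (seq (word * oterm)).

(* Names are tagged so that they never clash: the function names of the formula
   start with true, true, the constants standing for free variables with true,
   false, its predicate names with true, and new symbols with false. *)
Fixpoint lookup (x : word) (s : osubst) : oterm :=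
  match s with
  | [::] => OApp (OFun [:: true, false & x]) [::]
  | (y, t) :: s' => if x == y then t else lookup x s'
  end.

Fixpoint trans_term (s : osubst) (t : term) : oterm :=
  match t with
  | TVar x => lookup x s
  | TFun f ts => OApp (OFun [:: true, true & f]) (map (trans_term s) ts)
  end.

(** The arguments [ys] are the threshold and the variables introduced so far: Skolem terms depend on
    both, hence so does the value of the subformula at [p]. *)
Definition value_term (p : word) (ys : seq oterm) : oterm :=
  OApp (OPred (false :: p)) ys.

Arguments value_term : simpl never.

(* A node of the formula is identified by its path from the root, the last step
   coming first. *)
Fixpoint value_clauses (s : osubst) (ys : seq oterm) (A : formula) (p : word) :
    oclauses :=
  let v := value_term p ys in
  let p0 := false :: p in
  let p1 := true :: p in
  let v0 := value_term p0 ys in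
  let v1 := value_term p1 ys in
  match A with
  | FAtom q ts =>
      let a := OApp (OPred (true :: q)) (map (trans_term s) ts) in
      [:: [:: OLe v a]; [:: OLe a v]]
  | FBot => [:: [:: OLe v OBot]]
  | FTop => [:: [:: OLe OTop v]]
  | FAnd B C =>
      [:: [:: OLe v v0]; [:: OLe v v1]; [:: OLe v0 v; OLe v1 v]]
        ++ value_clauses s ys B p0 ++ value_clauses s ys C p1
  | FOr B C =>
      [:: [:: OLe v0 v]; [:: OLe v1 v]; [:: OLe v v0; OLe v v1]]
        ++ value_clauses s ys B p0 ++ value_clauses s ys C p1
  | FImp B C =>
      [:: [:: OLt v1 v0; OLe OTop v]; [:: OLe v0 v1; OLe v v1];
          [:: OLe v1 v]]
        ++ value_clauses s ys B p0 ++ value_clauses s ys C p1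
  | FDelta B =>
      [:: [:: OLt v0 OTop; OLe OTop v]; [:: OLe OTop v0; OLe v OBot]]
        ++ value_clauses s ys B p0
  | FAll _ _ | FEx _ _ => [::]
  end.

(* A universally quantified u for satisfiability, the constant c for validity. *)
Definition threshold (sat : bool) : oterm :=
  if sat then OVar [::] else OApp (OFun [::]) [::].

Definition matrix_clauses (sat : bool) (s : osubst) (ys : seq oterm)
    (A : formula) (p : word) : oclauses :=
  (if sat then [:: OLe OTop (threshold sat); OLt (threshold sat) (value_term p ys)]
   else [:: OLt (value_term p ys) (threshold sat)]) :: value_clauses s ys A p.

(** A conjunction exceeds [u] iff both conjuncts do, so with [sat] conjunctions are split; for
    validity a conjunction belongs to the matrix. A variable is named by its path tagged with
    [true]: the name is never the empty word of the threshold, and it is longer than the names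
    introduced above it. *)
Fixpoint prefix_clauses (sat : bool) (s : osubst) (ys : seq oterm)
    (A : formula) (p : word) : oclauses :=
  match A with
  | FAnd B C =>
      if sat then
        prefix_clauses sat s ys B (false :: p) ++
        prefix_clauses sat s ys C (true :: p)
      else matrix_clauses sat s ys A p
  | FAll x B =>
      if sat then
        prefix_clauses sat ((x, OVar (true :: p)) :: s)
          (OVar (true :: p) :: ys) B (false :: p)
      else
        prefix_clauses sat ((x, OApp (OFun (false :: p)) ys) :: s)
          ys B (false :: p)
  | FEx x B =>
      if sat then
        prefix_clauses sat ((x, OApp (OFun (false :: p)) ys) :: s)
          ys B (false :: p)
      else
        prefix_clauses sat ((x, OVar (true :: p)) :: s)
          (OVar (true :: p) :: ys) B (false :: p)
  | _ => matrix_clauses sat s ys A p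
  end.

Definition sat_clauses (A : formula) : oclauses :=
  prefix_clauses true [::] [:: threshold true] A [::].

Definition val_clauses (A : formula) : oclauses :=
  [:: OLt (threshold false) OTop]
    :: prefix_clauses false [::] [:: threshold false] A [::].

(** * Cost of programs *)

(* C bounds the cost of running function f on u, without that of evaluating the
   argument. *)
Definition callcost (P : program) (f : nat) (u v : tree) (C : nat) : Prop :=
  exists body c, [/\ onth P f = Some body, eval P [:: u] body v c & c <= C].

(* Evaluation where only the costs of calls are counted, and the results of calls
   have size at most N. *)
Inductive traced (P : program) (N : nat) : seq tree -> expr -> tree -> nat -> Prop :=
| traced_var env i v :
    onth env i = Some v -> traced P N env (EVar i) v 0
| traced_nil env : traced P N env ENil Nil 0
| traced_cons env el er l r Tl Tr :
    traced P N env el l Tl -> traced P N env er r Tr ->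
    traced P N env (ECons el er) (Cons l r) (Tl + Tr)
| traced_case_nil env e e_nil e_cons v T T' :
    traced P N env e Nil T -> traced P N env e_nil v T' ->
    traced P N env (ECase e e_nil e_cons) v (T + T')
| traced_case_cons env e e_nil e_cons l r v T T' :
    traced P N env e (Cons l r) T -> traced P N [:: l, r & env] e_cons v T' ->
    traced P N env (ECase e e_nil e_cons) v (T + T')
| traced_call env f e u v T C :
    traced P N env e u T -> callcost P f u v C -> tree_size v <= N ->
    traced P N env (ECall f e) v (T + C).

(** Merging both case rules lets a branch be selected by computing the scrutinee [u]. *)
Lemma traced_case P N env e e_nil e_cons u v T T' :
  traced P N env e u T ->
  match u with
  | Nil => traced P N env e_nil v T'
  | Cons l r => traced P N [:: l, r & env] e_cons v T'
  end ->
  traced P N env (ECase e e_nil e_cons) v (T + T').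
Proof.
by case: u => [|l r]; [exact: traced_case_nil|exact: traced_case_cons].
Qed.

(** The factor by which a result may exceed a common bound on the environment and on the results of
    calls. The cons branch sees an environment enlarged by the scrutinee, hence the factor
    [1 + growth e]; [overhead] treats costs in the same way. *)
Fixpoint growth (e : expr) : nat :=
  match e with
  | EVar _ | ENil | ECall _ _ => 1
  | ECons l r => growth l + growth r + 1
  | ECase e e_nil e_cons => growth e_nil + growth e_cons * (1 + growth e)
  end.

Fixpoint overhead (e : expr) : nat :=
  match e with
  | EVar _ | ENil => 1
  | ECons l r => overhead l + overhead r + growth (ECons l r)
  | ECase e0 e_nil e_cons =>
      overhead e0 + overhead e_nil + overhead e_cons * (1 + growth e0)
        + growth (ECase e0 e_nil e_cons)
  | ECall _ e => overhead e + 1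
  end.

Lemma tree_size_gt0 t : 0 < tree_size t.
Proof. by case: t. Qed.

Lemma onth_size_le env i v :
  onth env i = Some v -> tree_size v <= sumn (map tree_size env).
Proof.
elim: env i => [|u env IH] [|i] //= [].
  by move=> ->; exact: leq_addr.
by move/IH => h; apply: leq_trans h _; exact: leq_addl.
Qed.

(** Induction on the derivation, with [M] general because the cons branch of a case needs a larger
    bound. Everything except the calls costs linearly in [M], with a factor depending only on the
    expression. *)
Fixpoint traced_cost P N env e v T (h : traced P N env e v T) {struct h} :
  forall M, N <= M -> 0 < M -> sumn (map tree_size env) <= M ->
  tree_size v <= growth e * M /\
  exists2 c, eval P env e v c & c <= overhead e * M + T.
Proof.
case: h => {env e v T}.
- move=> env i v iv M NM M0 eM; have vM := leq_trans (onth_size_le iv) eM.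
  by split; [rewrite mul1n|exists (tree_size v); [exact: eval_var|rewrite /= mul1n addn0]].
- move=> env M NM M0 eM; split; first by rewrite mul1n.
  by exists 1; [exact: eval_nil|rewrite /= mul1n addn0].
- move=> env el er l r Tl Tr hl hr M NM M0 eM.
  have [sl [cl el' bl]] := traced_cost _ _ _ _ _ _ hl M NM M0 eM.
  have [sr [cr er' br]] := traced_cost _ _ _ _ _ _ hr M NM M0 eM.
  split; first by move: sl sr; rewrite /=; lia.
  by eexists; [exact: eval_cons el' er'|move: sl sr bl br; rewrite /=; lia].
- move=> env e e_nil e_cons v T T' hu hv M NM M0 eM.
  have [su [cu eu bu]] := traced_cost _ _ _ _ _ _ hu M NM M0 eM.
  have [sv [cv ev bv]] := traced_cost _ _ _ _ _ _ hv M NM M0 eM.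
  split; first by move: sv; rewrite /=; lia.
  by eexists; [exact: eval_case_nil eu ev|move: sv bv bu; rewrite /=; lia].
- move=> env e e_nil e_cons l r v T T' hu hv M NM M0 eM.
  have [su [cu eu bu]] := traced_cost _ _ _ _ _ _ hu M NM M0 eM.
  (* Head and tail of the scrutinee add at most its size, bounded by [growth e * M], to the
     environment. *)
  have [||| sv [cv ev bv]] := traced_cost _ _ _ _ _ _ hv (M * (1 + growth e)).
  + by apply: leq_trans NM _; rewrite leq_pmulr.
  + by rewrite muln_gt0 M0.
  + by move: su eM; rewrite /=; lia.
  split; first by move: sv; rewrite /=; lia.
  by eexists; [exact: eval_case_cons eu ev|move: sv bv bu; rewrite /=; lia].
- move=> env f e u v T C hu [body [c [fb ev cC]]] vN M NM M0 eM.
  have [su [cu eu bu]] := traced_cost _ _ _ _ _ _ hu M NM M0 eM.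
  split; first by rewrite /=; lia.
  by eexists; [exact: eval_call eu fb ev|move: bu; rewrite /=; lia].
Qed.

Definition max_overhead (P : program) : nat := sumn (map overhead P).

(** The accounting rule for all functions below: one activation costs [max_overhead P * N], and only
    the calls it makes are added. The equation [v = w] lets the result be computed first and
    compared with its specification afterwards. *)
Lemma callcost_traced P N f body u v w T C :
  onth P f = Some body -> traced P N [:: u] body v T -> v = w ->
  tree_size u <= N -> max_overhead P * N + T <= C -> callcost P f u w C.
Proof.
move=> fb tr <- uN bC.
have [||| _ [c ev bc]] := traced_cost tr (M := N) => //.
- exact: leq_trans (tree_size_gt0 u) uN.
- by rewrite /= addn0.
exists body, c; split=> //; apply: leq_trans bc (leq_trans _ bC).
rewrite leq_add2r leq_mul2r; apply/orP; right.
elim: P f fb {tr ev bC} => [|b P IH] [|f] //=; first by case=> ->; exact: leq_addr.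
by move/IH => h; apply: leq_trans h _; exact: leq_addl.
Qed.

Lemma callcost_le P f u v C C' : callcost P f u v C -> C <= C' -> callcost P f u v C'.
Proof. by case=> b [c [h1 h2 h3]] h; exists b, c; split=> //; exact: leq_trans h. Qed.

(** * A program for the translation *)

Definition EHd (e : expr) := ECase e ENil (EVar 0).
Definition ETl (e : expr) := ECase e ENil (EVar 1).
Definition ETrue := ECons ENil ENil.
Definition EList (es : seq expr) : expr := foldr ECons ENil es.
Definition EConstr (n : nat) (es : seq expr) : expr :=
  ECons (iter n (ECons ENil) ENil) (EList es).

Definition EOVar (x : expr) := EConstr 0 [:: x].
Definition EOBot := EConstr 1 [::].
Definition EOTop := EConstr 2 [::].
Definition EOFun (f ts : expr) := EConstr 3 [:: EConstr 0 [:: f]; ts].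
Definition EOPred (p ts : expr) := EConstr 3 [:: EConstr 1 [:: p]; ts].
Definition ELt (s t : expr) := EConstr 0 [:: s; t].
Definition ELe (s t : expr) := EConstr 1 [:: s; t].
Definition EValue (p ys : expr) := EOPred (ECons ENil p) ys.

(* Branches on the constructor number to which e evaluates; branch i is given
   the index of the variable that was k before 2 * i variables were bound. *)
Fixpoint ESwitch (k : nat) (e : expr) (bs : seq (nat -> expr)) : expr :=
  if bs is b :: bs' then ECase e (b k) (ESwitch k.+2 (EVar 1) bs') else ENil.

Definition EArg (k i : nat) : expr := EHd (iter i ETl (EVar k)).
Definition ERest (k i : nat) : expr := iter i ETl (EVar k).

Definition eq_fun := 1.
Definition lookup_fun := 2.
Definition term_fun := 3.
Definition terms_fun := 4.
Definition value_fun := 5.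
Definition prefix_fun := 6.

Definition eq_body : expr :=
  ECase (EHd (EVar 0))
    (ECase (ETl (EVar 0)) ETrue ENil)
    (ECase (ETl (EVar 2)) ENil
       (ECase (ECall eq_fun (ECons (EVar 2) (EVar 0))) ENil
          (ECall eq_fun (ECons (EVar 5) (EVar 3))))).

Definition lookup_body : expr :=
  ECase (ETl (EVar 0))
    (EOFun (ECons ETrue (ECons ENil (EHd (EVar 0)))) ENil)
    (ECase (ECall eq_fun (ECons (EHd (EVar 2)) (EHd (EVar 0))))
       (ECall lookup_fun (ECons (EHd (EVar 2)) (EVar 1)))
       (ETl (EVar 2))).

Definition term_body : expr :=
  ECase (EHd (ETl (EVar 0)))
    (ECall lookup_fun (ECons (EHd (ETl (ETl (EVar 0)))) (EHd (EVar 0))))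
    (EOFun (ECons ETrue (ECons ETrue (EHd (ETl (ETl (EVar 2))))))
       (ECall terms_fun
          (ECons (EHd (EVar 2)) (EHd (ETl (ETl (ETl (EVar 2)))))))).

Definition terms_body : expr :=
  ECase (ETl (EVar 0)) ENil
    (ECons (ECall term_fun (ECons (EHd (EVar 2)) (EVar 0)))
       (ECall terms_fun (ECons (EHd (EVar 2)) (EVar 1)))).

(* The argument is (A, p, s, ys, acc), nested to the right. *)
Section ValueBody.
Variable k : nat.
Definition EChild (i : nat) : expr := EHd (iter i ETl (ETl (EArg k 0))).
Definition EValue_at (q : expr -> expr) : expr := EValue (q (EArg k 1)) (EArg k 3).
Definition EV := EValue_at id.
Definition EV0 := EValue_at (ECons ENil).
Definition EV1 := EValue_at (ECons ETrue).
Definition EValue_call (B b acc : expr) : expr :=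
  ECall value_fun
    (ECons B (ECons (ECons b (EArg k 1)) (ECons (EArg k 2) (ECons (EArg k 3) acc)))).
Definition EBoth : expr :=
  EValue_call (EChild 0) ENil (EValue_call (EChild 1) ETrue (ERest k 4)).
Definition EClauses (Cs : seq (seq expr)) (acc : expr) : expr :=
  foldr ECons acc (map EList Cs).
Definition EAtom : expr :=
  EOPred (ECons ETrue (EChild 0)) (ECall terms_fun (ECons (EArg k 2) (EChild 1))).
End ValueBody.

Definition value_body : expr :=
  ESwitch 0 (EHd (EArg 0 0))
    [:: fun k => EClauses [:: [:: ELe (EV k) (EAtom k)]; [:: ELe (EAtom k) (EV k)]] (ERest k 4);
        fun k => EClauses [:: [:: ELe (EV k) EOBot]] (ERest k 4);
        fun k => EClauses [:: [:: ELe EOTop (EV k)]] (ERest k 4);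
        fun k => EClauses [:: [:: ELe (EV k) (EV0 k)]; [:: ELe (EV k) (EV1 k)];
                              [:: ELe (EV0 k) (EV k); ELe (EV1 k) (EV k)]] (EBoth k);
        fun k => EClauses [:: [:: ELe (EV0 k) (EV k)]; [:: ELe (EV1 k) (EV k)];
                              [:: ELe (EV k) (EV0 k); ELe (EV k) (EV1 k)]] (EBoth k);
        fun k => EClauses [:: [:: ELt (EV1 k) (EV0 k); ELe EOTop (EV k)];
                              [:: ELe (EV0 k) (EV1 k); ELe (EV k) (EV1 k)];
                              [:: ELe (EV1 k) (EV k)]] (EBoth k);
        fun k => EClauses [:: [:: ELt (EV0 k) EOTop; ELe EOTop (EV k)];
                              [:: ELe EOTop (EV0 k); ELe (EV k) EOBot]]
                   (EValue_call k (EChild k 0) ENil (ERest k 4));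
        fun k => ERest k 4;
        fun k => ERest k 4].

Definition EThreshold (sat : bool) : expr :=
  if sat then EOVar ENil else EOFun ENil ENil.

(* The argument is (sat, A, p, s, ys, acc), nested to the right. *)
Section PrefixBody.
Variable k : nat.
Definition EPrefix_child (i : nat) : expr := EHd (iter i ETl (ETl (EArg k 1))).
Definition EMatrix : expr :=
  ECons
    (ECase (EArg k 0)
       (EList [:: ELt (EValue (EArg k 2) (EArg k 4)) (EThreshold false)])
       (EList [:: ELe EOTop (EThreshold true);
                  ELt (EThreshold true) (EValue (EArg k.+2 2) (EArg k.+2 4))]))
    (ECall value_fun (ERest k 1)).
Definition EPrefix_call (B b s ys acc : expr) : expr :=
  ECall prefix_fun
    (ECons (EArg k 0) (ECons B (ECons (ECons b (EArg k 2)) (ECons s (ECons ys acc))))).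
Definition EBind (t ys : expr) : expr :=
  EPrefix_call (EPrefix_child 1) ENil (ECons (ECons (EPrefix_child 0) t) (EArg k 3)) ys (ERest k 5).
Definition EVariable : expr := EOVar (ECons ETrue (EArg k 2)).
Definition EUniversal : expr := EBind EVariable (ECons EVariable (EArg k 4)).
Definition ESkolem : expr :=
  EBind (EOFun (ECons ENil (EArg k 2)) (EArg k 4)) (EArg k 4).
Definition EConj : expr :=
  EPrefix_call (EPrefix_child 0) ENil (EArg k 3) (EArg k 4)
    (EPrefix_call (EPrefix_child 1) ETrue (EArg k 3) (EArg k 4) (ERest k 5)).
End PrefixBody.

Definition prefix_body : expr :=
  ESwitch 0 (EHd (EArg 0 1))
    [:: EMatrix; EMatrix; EMatrix;
        fun k => ECase (EArg k 0) (EMatrix k) (EConj k.+2);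
        EMatrix; EMatrix; EMatrix;
        fun k => ECase (EArg k 0) (ESkolem k) (EUniversal k.+2);
        fun k => ECase (EArg k 0) (EUniversal k) (ESkolem k.+2)].

Definition main_body (sat : bool) : expr :=
  let call := ECall prefix_fun
    (EList [:: if sat then ETrue else ENil; EVar 0; ENil; ENil;
               EList [:: EThreshold sat]]) in
  if sat then call else ECons (EList [:: ELt (EThreshold false) EOTop]) call.

Definition clauses_program (sat : bool) : program :=
  [:: main_body sat; eq_body; lookup_body; term_body; terms_body; value_body;
      prefix_body].

(** * Sizes of encodings and symbolic evaluation of programs *)

Fixpoint tree_eqb (t u : tree) : bool :=
  match t, u with
  | Nil, Nil => true
  | Cons t1 t2, Cons u1 u2 => tree_eqb t1 u1 && tree_eqb t2 u2
  | _, _ => false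
  end.

Arguments enc_word : simpl never.

Lemma enc_word_cons b (w : word) :
  enc_word (b :: w) = Cons (enc_bool b) (enc_word w).
Proof. by []. Qed.

Lemma tree_eqb_word (x y : word) : tree_eqb (enc_word x) (enc_word y) = (x == y).
Proof.
elim: x y => [|a x IH] [|b y] //.
by rewrite !enc_word_cons eqseq_cons -IH; case: a; case: b.
Qed.

(** The programs prepend clauses to an accumulator, so that no list is ever concatenated. *)
Definition enc_onto (S : oclauses) (acc : tree) : tree :=
  foldr Cons acc (map enc_oclause S).

Lemma enc_onto_cat S S' acc :
  enc_onto (S ++ S') acc = enc_onto S (enc_onto S' acc).
Proof. by rewrite /enc_onto map_cat foldr_cat. Qed.

Definition enc_osubst (s : osubst) : tree :=
  enc_list (map (fun b => Cons (enc_word b.1) (enc_oterm b.2)) s).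

Notation enc_terms ts := (enc_list (map enc_term ts)).
Notation enc_oterms ts := (enc_list (map enc_oterm ts)).

Lemma size_enc_lookup x s :
  tree_size (enc_oterm (lookup x s)) <=
  tree_size (enc_word x) + tree_size (enc_osubst s) + 40.
Proof.
elim: s => [|[y t] s IH].
  rewrite /= -/(enc_word x); lia.
rewrite /enc_osubst /= -/(enc_osubst s).
by case: eqP => _; [|apply: leq_trans IH _]; lia.
Qed.

Lemma size_enc_trans_terms s (ts : seq term) :
  List.Forall (fun t => tree_size (enc_oterm (trans_term s t)) <=
    tree_size (enc_term t) * (tree_size (enc_osubst s) + 40)) ts ->
  tree_size (enc_oterms (map (trans_term s) ts)) <=
  tree_size (enc_terms ts) * (tree_size (enc_osubst s) + 40).
Proof. by elim => [|t ts' ht _ IH] /=; lia. Qed.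

(** Each variable occurrence may be replaced by a term of [s] or by a tagged constant, so the size
    grows by at most a factor linear in the size of [s]. *)
Lemma size_enc_trans_term s t :
  tree_size (enc_oterm (trans_term s t)) <=
  tree_size (enc_term t) * (tree_size (enc_osubst s) + 40).
Proof.
elim/term_nested_ind: t => [x|f ts /size_enc_trans_terms IH].
  have := size_enc_lookup x s; have := tree_size_gt0 (enc_osubst s).
  rewrite /= -/(enc_word x); nia.
have := tree_size_gt0 (enc_osubst s); move: IH; rewrite /=.
by rewrite -/(enc_word f); lia.
Qed.

Ltac reduce_match :=
  cbv beta iota;
  try lazymatch goal with
  | |- match ?u with Nil => _ | Cons _ _ => _ end =>
      let u' := eval hnf in u in change u with u'; cbv beta iota
  end.

(** Follows the expression and builds the derivation; for each call it leaves two goals, its cost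
    and the size of its result. *)
Ltac evaluate :=
  lazymatch goal with
  | |- traced ?P ?N ?env ?e ?v ?T =>
    let e' := eval hnf in e in
    lazymatch e' with
    | EVar _ => eapply traced_var; reflexivity
    | ENil => eapply traced_nil
    | ECons _ _ => eapply traced_cons; [evaluate | evaluate]
    | ECase _ _ _ => eapply traced_case; [evaluate | reduce_match; evaluate]
    | ECall ?f ?a => let f' := eval hnf in f in
        change (traced P N env (ECall f' a) v T);
        eapply traced_call; [evaluate | | ]
    end
  end.

Arguments max_overhead : simpl never.

(** * Cost of comparing words, looking up variables and translating terms *)

Section Program.
Variables (sat : bool) (N : nat).
Local Notation P := (clauses_program sat).
Local Notation U := (max_overhead P * N).

Lemma eq_cost t u : tree_size t + tree_size u < N ->
  callcost P 1 (Cons t u) (enc_bool (tree_eqb t u)) (tree_size t * U).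
Proof.
elim: t u => [|t1 IH1 t2 IH2] [|u1 u2] /= tuN.
- eapply (@callcost_traced _ N); [reflexivity|evaluate|reflexivity|..]; rewrite /=; lia.
- eapply (@callcost_traced _ N); [reflexivity|evaluate|reflexivity|..]; rewrite /=; lia.
- eapply (@callcost_traced _ N); [reflexivity|evaluate|reflexivity|..]; rewrite /=; lia.
have h1 := IH1 u1; have h2 := IH2 u2.
(* The result of the first recursive call decides whether the second one is made, so the cases are
   separated before evaluation. *)
case: (tree_eqb t1 u1) h1 => /= h1.
{ eapply (@callcost_traced _ N); [reflexivity| | |..].
    eapply traced_case; [evaluate|reduce_match].
    eapply traced_case; [evaluate|reduce_match].
    eapply traced_case.
      eapply traced_call; [evaluate|apply: h1; lia|by rewrite /=; lia].
    reduce_match; evaluate; first by apply: h2; lia.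
    by case: tree_eqb => /=; lia.
  all: rewrite /=; try reflexivity; lia. }
eapply (@callcost_traced _ N); [reflexivity| | |..].
  eapply traced_case; [evaluate|reduce_match].
  eapply traced_case; [evaluate|reduce_match].
  eapply traced_case.
    eapply traced_call; [evaluate|apply: h1; lia|by rewrite /=; lia].
  reduce_match; evaluate.
all: rewrite /=; try reflexivity; lia.
Qed.

(** One activation and one comparison of words of size at most [N]. *)
Definition lookup_step := U + N * U.

Lemma lookup_cost x s :
  tree_size (enc_word x) + tree_size (enc_osubst s) + 40 <= N ->
  callcost P 2 (Cons (enc_word x) (enc_osubst s)) (enc_oterm (lookup x s))
    (tree_size (enc_osubst s) * lookup_step).
Proof.
rewrite /lookup_step.
elim: s => [|[y t] s IH].
  rewrite /enc_osubst /= => h.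
  eapply (@callcost_traced _ N); [reflexivity|evaluate|reflexivity|..]; rewrite /=; lia.
rewrite /enc_osubst /= -/(enc_osubst s) => h.
have E : callcost P 1 (Cons (enc_word x) (enc_word y)) (enc_bool (x == y)) (N * U).
  rewrite -tree_eqb_word; apply: callcost_le; first by apply: eq_cost; lia.
  by rewrite leq_mul2r; apply/orP; right; lia.
case: (x == y) E => /= E.
{ eapply (@callcost_traced _ N); [reflexivity| | |..].
    eapply traced_case; [evaluate|reduce_match].
    eapply traced_case.
      eapply traced_call; [evaluate|exact: E|by rewrite /=; lia].
    reduce_match; evaluate.
  all: rewrite /=; try reflexivity; lia. }
eapply (@callcost_traced _ N); [reflexivity| | |..].
  eapply traced_case; [evaluate|reduce_match].
  eapply traced_case.
    eapply traced_call; [evaluate|exact: E|by rewrite /=; lia].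
  reduce_match; evaluate; first by apply: IH; lia.
  by apply: leq_trans (size_enc_lookup _ _) _; lia.
all: rewrite /=; try reflexivity; lia.
Qed.

Definition term_step := U + N * lookup_step.

(** The two translation functions call each other; this half assumes the cost of the members and is
    used inside the nested induction of [term_cost]. *)
Lemma terms_cost_Forall s ts :
  tree_size (enc_terms ts) * (tree_size (enc_osubst s) + 40) <= N ->
  List.Forall (fun t =>
    tree_size (enc_term t) * (tree_size (enc_osubst s) + 40) <= N ->
    callcost P 3 (Cons (enc_osubst s) (enc_term t)) (enc_oterm (trans_term s t))
      (tree_size (enc_term t) * term_step)) ts ->
  callcost P 4 (Cons (enc_osubst s) (enc_terms ts))
    (enc_oterms (map (trans_term s) ts)) (tree_size (enc_terms ts) * term_step).
Proof.
move=> + h; elim: h => [|t ts' ht hts IH] /= hN.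
  rewrite /term_step.
  eapply (@callcost_traced _ N); [reflexivity|evaluate|reflexivity|..];
    rewrite /=; lia.
eapply (@callcost_traced _ N); [reflexivity|evaluate|reflexivity|..].
- by apply: ht; lia.
- by apply: leq_trans (size_enc_trans_term _ _) _; lia.
- by apply: IH; lia.
- apply: leq_trans (size_enc_trans_terms _) _; last by lia.
  by apply/List.Forall_forall => t' _; exact: size_enc_trans_term.
- by have := tree_size_gt0 (enc_term t); rewrite /=; nia.
- by have : U <= term_step by [rewrite /term_step; lia]; rewrite /=; lia.
Qed.

Lemma term_cost s t :
  tree_size (enc_term t) * (tree_size (enc_osubst s) + 40) <= N ->
  callcost P 3 (Cons (enc_osubst s) (enc_term t)) (enc_oterm (trans_term s t))
    (tree_size (enc_term t) * term_step).
Proof.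
have UW : U <= term_step by rewrite /term_step; lia.
have LW : tree_size (enc_osubst s) <= N ->
    tree_size (enc_osubst s) * lookup_step + U <= term_step.
  by move=> sN; rewrite /term_step addnC leq_add2l leq_mul2r sN orbT.
elim/term_nested_ind: t => [x|f ts IH].
  rewrite /= -/(enc_word x) => hN.
  have s0 := tree_size_gt0 (enc_osubst s).
  have sN : tree_size (enc_osubst s) <= N by nia.
  eapply (@callcost_traced _ N); [reflexivity|evaluate|reflexivity|..].
  - by apply: lookup_cost; nia.
  - by apply: leq_trans (size_enc_lookup _ _) _; nia.
  - by rewrite /=; nia.
  - by have := LW sN; rewrite /=; lia.
rewrite /= -/(enc_word f) => hN.
eapply (@callcost_traced _ N); [reflexivity|evaluate|reflexivity|..].
- by apply: terms_cost_Forall => //; lia.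
- apply: leq_trans (size_enc_trans_terms _) _; last by lia.
  by apply/List.Forall_forall => t' _; exact: size_enc_trans_term.
- by rewrite /=; nia.
- by rewrite /=; lia.
Qed.

Lemma terms_cost s ts :
  tree_size (enc_terms ts) * (tree_size (enc_osubst s) + 40) <= N ->
  callcost P 4 (Cons (enc_osubst s) (enc_terms ts))
    (enc_oterms (map (trans_term s) ts)) (tree_size (enc_terms ts) * term_step).
Proof.
move=> h; apply: terms_cost_Forall h _.
by apply/List.Forall_forall => t _; exact: term_cost.
Qed.
End Program.

(** * Sizes of encoded clauses and formulas *)

Lemma enc_onto_cons C S acc :
  enc_onto (C :: S) acc = Cons (enc_oclause C) (enc_onto S acc).
Proof. by []. Qed.

Lemma enc_onto_nil acc : enc_onto [::] acc = acc.
Proof. by []. Qed.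

Definition enc_ontoE := (enc_onto_cat, enc_onto_cons, enc_onto_nil).

Lemma size_Cons l r : tree_size (Cons l r) = (tree_size l + tree_size r).+1.
Proof. by []. Qed.

Lemma size_enc_OLe s t : tree_size (enc_oliteral (OLe s t)) =
  tree_size (enc_oterm s) + tree_size (enc_oterm t) + 7.
Proof. by rewrite /=; lia. Qed.

Lemma size_enc_OLt s t : tree_size (enc_oliteral (OLt s t)) =
  tree_size (enc_oterm s) + tree_size (enc_oterm t) + 5.
Proof. by rewrite /=; lia. Qed.

Lemma size_enc_oclause l C : tree_size (enc_oclause (l :: C)) =
  (tree_size (enc_oliteral l) + tree_size (enc_oclause C)).+1.
Proof. by []. Qed.

Lemma size_enc_oclause_nil : tree_size (enc_oclause [::]) = 1.
Proof. by []. Qed.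

Lemma size_enc_OPred p ts : tree_size (enc_oterm (OApp (OPred p) ts)) =
  tree_size (enc_word p) + tree_size (enc_oterms ts) + 17.
Proof. by rewrite /= -/(enc_word p); lia. Qed.

Lemma size_enc_OFun p ts : tree_size (enc_oterm (OApp (OFun p) ts)) =
  tree_size (enc_word p) + tree_size (enc_oterms ts) + 15.
Proof. by rewrite /= -/(enc_word p); lia. Qed.

Lemma size_enc_OVar x : tree_size (enc_oterm (OVar x)) = tree_size (enc_word x) + 4.
Proof. by rewrite /= -/(enc_word x); lia. Qed.

Lemma size_enc_OBot : tree_size (enc_oterm OBot) = 5.
Proof. by []. Qed.

Lemma size_enc_OTop : tree_size (enc_oterm OTop) = 7.
Proof. by []. Qed.

Lemma size_enc_word b w : tree_size (enc_word (b :: w)) =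
  tree_size (enc_word w) + (if b then 4 else 2).
Proof. by rewrite enc_word_cons; case: b => /=; lia. Qed.

Lemma size_enc_word_nil : tree_size (enc_word [::]) = 1.
Proof. by []. Qed.

Lemma size_enc_value_term p ys : tree_size (enc_oterm (value_term p ys)) =
  tree_size (enc_word p) + tree_size (enc_oterms ys) + 19.
Proof. by rewrite size_enc_OPred size_enc_word; lia. Qed.

Definition size_encE := (size_enc_value_term, size_Cons, size_enc_OLe,
  size_enc_OLt, size_enc_oclause,
  size_enc_oclause_nil, size_enc_OPred, size_enc_OFun, size_enc_OVar,
  size_enc_OBot, size_enc_OTop, size_enc_word, size_enc_word_nil).

Lemma size_FAtom q ts :
  tree_size (enc_formula (FAtom q ts)) =
  tree_size (enc_word q) + tree_size (enc_terms ts) + 5.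
Proof. by rewrite /= -/(enc_word q); lia. Qed.

Lemma size_FAnd B C : tree_size (enc_formula (FAnd B C)) =
  tree_size (enc_formula B) + tree_size (enc_formula C) + 11.
Proof. by rewrite /=; lia. Qed.

Lemma size_FOr B C : tree_size (enc_formula (FOr B C)) =
  tree_size (enc_formula B) + tree_size (enc_formula C) + 13.
Proof. by rewrite /=; lia. Qed.

Lemma size_FImp B C : tree_size (enc_formula (FImp B C)) =
  tree_size (enc_formula B) + tree_size (enc_formula C) + 15.
Proof. by rewrite /=; lia. Qed.

Lemma size_FDelta B : tree_size (enc_formula (FDelta B)) =
  tree_size (enc_formula B) + 16.
Proof. by rewrite /=; lia. Qed.

Lemma size_FAll x B : tree_size (enc_formula (FAll x B)) =
  tree_size (enc_word x) + tree_size (enc_formula B) + 19.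
Proof. by rewrite /= -/(enc_word x); lia. Qed.

Lemma size_FEx x B : tree_size (enc_formula (FEx x B)) =
  tree_size (enc_word x) + tree_size (enc_formula B) + 21.
Proof. by rewrite /= -/(enc_word x); lia. Qed.

Lemma size_FBot : tree_size (enc_formula FBot) = 5.
Proof. by []. Qed.

Lemma size_FTop : tree_size (enc_formula FTop) = 7.
Proof. by []. Qed.

Definition size_formulaE := (size_FAtom, size_FBot, size_FTop, size_FAnd, size_FOr, size_FImp,
  size_FDelta, size_FAll, size_FEx).

Lemma formula_size_gt2 A : 2 < tree_size (enc_formula A).
Proof. by case: A => *; rewrite ?size_formulaE //; lia. Qed.

(** * Size and cost of the clauses defining the values of subformulas *)

Section Formulas.
Variables (M Q : nat).
Hypothesis MQ : 20 * M + 600 <= Q.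

Lemma size_enc_terms s ts :
  tree_size (enc_oterms (map (trans_term s) ts)) <=
  tree_size (enc_terms ts) * (tree_size (enc_osubst s) + 40).
Proof.
apply: size_enc_trans_terms; apply/List.Forall_forall => t _.
exact: size_enc_trans_term.
Qed.

(** Each connective contributes a fixed number of literals of size linear in [M], and an atom two
    copies of its translated arguments; [Q] pays for this per unit of formula size. A step lengthens
    the encoded path by at most 4, which the multiple of the formula size in the first hypothesis
    covers. *)
Lemma size_value_clauses s ys A p acc :
  tree_size (enc_word p) + 4 * tree_size (enc_formula A) <= M ->
  tree_size (enc_osubst s) <= M -> tree_size (enc_oterms ys) <= M ->
  tree_size (enc_onto (value_clauses s ys A p) acc) <=
  tree_size acc + tree_size (enc_formula A) * Q.
Proof.
move=> + hs hy.
elim: A p acc => [q ts|||B IB C IC|B IB C IC|B IB C IC|B IB|x B IB|x B IB]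
    p acc; rewrite ?size_formulaE => hp;
  rewrite [value_clauses _ _ _ _]/= ?enc_ontoE ?size_encE.
- have h := size_enc_terms s ts.
  have : tree_size (enc_terms ts) * (tree_size (enc_osubst s) + 40) <=
    tree_size (enc_terms ts) * (M + 40) by rewrite leq_mul2l leq_add2r hs orbT.
  have : tree_size (enc_terms ts) * (20 * M + 600) <= tree_size (enc_terms ts) * Q.
    by rewrite leq_mul2l MQ orbT.
  lia.
- by rewrite /=; lia.
- by rewrite /=; lia.
- move: (IB (false :: p) (enc_onto (value_clauses s ys C (true :: p)) acc))
    (IC (true :: p) acc).
  by rewrite !size_encE => /(_ ltac:(lia)) hB /(_ ltac:(lia)) hC; lia.
- move: (IB (false :: p) (enc_onto (value_clauses s ys C (true :: p)) acc))
    (IC (true :: p) acc).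
  by rewrite !size_encE => /(_ ltac:(lia)) hB /(_ ltac:(lia)) hC; lia.
- move: (IB (false :: p) (enc_onto (value_clauses s ys C (true :: p)) acc))
    (IC (true :: p) acc).
  by rewrite !size_encE => /(_ ltac:(lia)) hB /(_ ltac:(lia)) hC; lia.
- move: (IB (false :: p) acc).
  by rewrite !size_encE => /(_ ltac:(lia)) hB; lia.
- exact: leq_addr.
- exact: leq_addr.
Qed.

Variables (sat : bool) (N : nat).
Local Notation P := (clauses_program sat).
Local Notation U := (max_overhead P * N).

(** An atom occurs in two clauses and its arguments are translated once for each. *)
Definition value_step := U + 2 * term_step sat N.

Definition value_arg (s : osubst) (ys : seq oterm) (A : formula) (p : word)
    (acc : tree) : tree :=
  Cons (enc_formula A)
    (Cons (enc_word p) (Cons (enc_osubst s) (Cons (enc_oterms ys) acc))).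

(** The clauses of the right subformula are added to the accumulator before those of the left one.
    They use up the share of [N] reserved for the right subformula, so the hypothesis on [acc] is
    preserved. *)
Lemma value_cost s ys A p acc :
  tree_size (enc_word p) + 4 * tree_size (enc_formula A) <= M ->
  tree_size (enc_osubst s) <= M -> tree_size (enc_oterms ys) <= M ->
  tree_size acc + tree_size (enc_formula A) * Q <= N ->
  callcost P 5 (value_arg s ys A p acc) (enc_onto (value_clauses s ys A p) acc)
    (tree_size (enc_formula A) * value_step).
Proof.
move=> + hs hy.
have argN A' p' acc' : tree_size (enc_word p') + 4 * tree_size (enc_formula A') <= M ->
    tree_size acc' + tree_size (enc_formula A') * Q <= N ->
    tree_size (value_arg s ys A' p' acc') <= N.
  move=> hp hN; have A2 := formula_size_gt2 A'; have := leq_mul (ltnW (ltnW A2)) (leqnn Q).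
  by rewrite mul1n /value_arg !size_Cons; lia.
have US : U <= value_step by rewrite /value_step; lia.
elim: A p acc => [q ts|||B IB C IC|B IB C IC|B IB C IC|B IB|x B IB|x B IB] p acc hp hN;
  have hu := argN _ _ _ hp hN; rewrite size_formulaE in hp hN *;
  set W := enc_onto _ _; rewrite /value_arg /= in hu *.
- have hts : tree_size (enc_terms ts) * (tree_size (enc_osubst s) + 40) <= N.
    apply: leq_trans (leq_trans (leq_addl _ _) hN).
    by apply: leq_mul; lia.
  eapply (@callcost_traced _ N); [reflexivity|evaluate| |exact: hu|].
  + exact: terms_cost hts.
  + exact: leq_trans (size_enc_terms _ _) hts.
  + exact: terms_cost hts.
  + exact: leq_trans (size_enc_terms _ _) hts.
  + reflexivity.
  + by move: US; rewrite /value_step; lia.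
- eapply (@callcost_traced _ N); [reflexivity|evaluate|reflexivity|exact: hu|].
  by lia.
- eapply (@callcost_traced _ N); [reflexivity|evaluate|reflexivity|exact: hu|].
  by lia.
- have hC := @size_value_clauses s ys C (true :: p) acc _ hs hy.
  have hB := @size_value_clauses s ys B (false :: p)
    (enc_onto (value_clauses s ys C (true :: p)) acc) _ hs hy.
  rewrite !size_encE in hB hC; have {}hC := hC ltac:(lia); have {}hB := hB ltac:(lia).
  eapply (@callcost_traced _ N); [reflexivity|evaluate| |exact: hu|].
  + by apply: (IC (true :: p) acc); rewrite ?size_encE; lia.
  + by lia.
  + by apply: (IB (false :: p)); rewrite ?size_encE; lia.
  + by lia.
  + by rewrite /W [value_clauses _ _ _ _]/= !enc_ontoE.
  + by lia.
- have hC := @size_value_clauses s ys C (true :: p) acc _ hs hy.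
  have hB := @size_value_clauses s ys B (false :: p)
    (enc_onto (value_clauses s ys C (true :: p)) acc) _ hs hy.
  rewrite !size_encE in hB hC; have {}hC := hC ltac:(lia); have {}hB := hB ltac:(lia).
  eapply (@callcost_traced _ N); [reflexivity|evaluate| |exact: hu|].
  + by apply: (IC (true :: p) acc); rewrite ?size_encE; lia.
  + by lia.
  + by apply: (IB (false :: p)); rewrite ?size_encE; lia.
  + by lia.
  + by rewrite /W [value_clauses _ _ _ _]/= !enc_ontoE.
  + by lia.
- have hC := @size_value_clauses s ys C (true :: p) acc _ hs hy.
  have hB := @size_value_clauses s ys B (false :: p)
    (enc_onto (value_clauses s ys C (true :: p)) acc) _ hs hy.
  rewrite !size_encE in hB hC; have {}hC := hC ltac:(lia); have {}hB := hB ltac:(lia).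
  eapply (@callcost_traced _ N); [reflexivity|evaluate| |exact: hu|].
  + by apply: (IC (true :: p) acc); rewrite ?size_encE; lia.
  + by lia.
  + by apply: (IB (false :: p)); rewrite ?size_encE; lia.
  + by lia.
  + by rewrite /W [value_clauses _ _ _ _]/= !enc_ontoE.
  + by lia.
- have hB := @size_value_clauses s ys B (false :: p) acc _ hs hy.
  rewrite !size_encE in hB; have {}hB := hB ltac:(lia).
  eapply (@callcost_traced _ N); [reflexivity|evaluate| |exact: hu|].
  + by apply: (IB (false :: p)); rewrite ?size_encE; lia.
  + by lia.
  + by rewrite /W [value_clauses _ _ _ _]/= !enc_ontoE.
  + by lia.
- eapply (@callcost_traced _ N); [reflexivity|evaluate|reflexivity|exact: hu|].
  by lia.
- eapply (@callcost_traced _ N); [reflexivity|evaluate|reflexivity|exact: hu|].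
  by lia.
Qed.
End Formulas.

(** * Size and cost of the clauses for the quantifier prefixes *)

Section Prefix.
Variables (M1 M2 M3 M Q : nat).
Hypotheses (M1M : M1 <= M) (M2M : M2 <= M) (M3M : M3 <= M).
Hypothesis MQ : 20 * M + 600 <= Q.

(* Descending to a subformula spends part of the budget proportional to the
   size of the formula on lengthening p, ys and s. *)
Definition budget (s : osubst) (ys : seq oterm) (a : nat) (p : word) : Prop :=
  [/\ tree_size (enc_word p) + 4 * a <= M1,
      tree_size (enc_oterms ys) + a * (M1 + 20) <= M2
    & tree_size (enc_osubst s) + a * (M1 + M2 + 40) <= M3].

Lemma size_enc_osubst_cons x t s : tree_size (enc_osubst ((x, t) :: s)) =
  tree_size (enc_word x) + tree_size (enc_oterm t) + tree_size (enc_osubst s) + 2.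
Proof. by rewrite /enc_osubst /= -/(enc_osubst s); lia. Qed.

Lemma size_enc_oterms_cons t ts : tree_size (enc_oterms (t :: ts)) =
  (tree_size (enc_oterm t) + tree_size (enc_oterms ts)).+1.
Proof. by []. Qed.

Lemma budget_child s ys a a' p b :
  a' < a -> budget s ys a p -> budget s ys a' (b :: p).
Proof.
move=> aa' [h1 h2 h3]; split.
- by rewrite size_enc_word; case: b; lia.
- by apply: leq_trans h2; rewrite leq_add2l leq_mul2r ltnW ?orbT.
- by apply: leq_trans h3; rewrite leq_add2l leq_mul2r ltnW ?orbT.
Qed.

Lemma budget_variable s ys a a' p x :
  a' + tree_size (enc_word x) + 1 < a -> budget s ys a p ->
  budget ((x, OVar (true :: p)) :: s) (OVar (true :: p) :: ys) a' (false :: p).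
Proof.
move=> aa' [h1 h2 h3].
have m k : a' * k + 2 * k <= a * k by rewrite -mulnDl leq_mul2r; apply/orP; right; lia.
split; rewrite ?size_enc_osubst_cons ?size_enc_oterms_cons !size_encE.
- by lia.
- by have := m (M1 + 20); lia.
- by have := m (M1 + M2 + 40); lia.
Qed.

(** The Skolem term contains [p] and all of [ys]; together with the bound name its size is at most
    [M1 + M2] plus a constant. This is why a unit of formula size is worth [M1 + M2 + 40] in the
    bound on [s]. *)
Lemma budget_skolem s ys a a' p x :
  a' + tree_size (enc_word x) + 1 < a -> budget s ys a p ->
  budget ((x, OApp (OFun (false :: p)) ys) :: s) ys a' (false :: p).
Proof.
move=> aa' [h1 h2 h3].
have m k : a' * k + 2 * k <= a * k by rewrite -mulnDl leq_mul2r; apply/orP; right; lia.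
split; rewrite ?size_enc_osubst_cons ?size_enc_oterms_cons ?size_encE.
- by lia.
- by have := m (M1 + 20); lia.
- by have := m (M1 + M2 + 40); lia.
Qed.

Lemma budgetW s ys a p : budget s ys a p ->
  [/\ tree_size (enc_word p) + 4 * a <= M, tree_size (enc_osubst s) <= M
    & tree_size (enc_oterms ys) <= M].
Proof. by case=> h1 h2 h3; split; lia. Qed.

(** The threshold clause costs at most one more [Q], absorbed by doubling the rate. *)
Lemma size_matrix_clauses b s ys A p acc :
  budget s ys (tree_size (enc_formula A)) p ->
  tree_size (enc_onto (matrix_clauses b s ys A p) acc) <=
  tree_size acc + tree_size (enc_formula A) * (2 * Q).
Proof.
case/budgetW=> h1 h2 h3; have hv := size_value_clauses MQ acc h1 h2 h3.
have A2 := formula_size_gt2 A.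
have : Q <= tree_size (enc_formula A) * Q by rewrite leq_pmull //; lia.
rewrite /matrix_clauses enc_onto_cons size_Cons /threshold.
by case: b; rewrite !size_encE /=; lia.
Qed.

Lemma size_prefix_clauses b s ys A p acc :
  budget s ys (tree_size (enc_formula A)) p ->
  tree_size (enc_onto (prefix_clauses b s ys A p) acc) <=
  tree_size acc + tree_size (enc_formula A) * (2 * Q).
Proof.
elim: A s ys p acc => [q ts|||B IB C IC|B IB C IC|B IB C IC|B IB|x B IB|x B IB]
  s ys p acc hA; try exact: size_matrix_clauses.
- rewrite [prefix_clauses _ _ _ _ _]/=.
  case: b IB IC => [IB IC|_ _]; last exact: size_matrix_clauses.
  rewrite size_FAnd in hA *; rewrite enc_onto_cat.
  have bC : budget s ys (tree_size (enc_formula C)) (true :: p).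
    by apply: budget_child hA; lia.
  have bB : budget s ys (tree_size (enc_formula B)) (false :: p).
    by apply: budget_child hA; lia.
  have hC := IC _ _ _ acc bC; have hB := IB _ _ _
    (enc_onto (prefix_clauses true s ys C (true :: p)) acc) bB.
  by lia.
- rewrite size_FAll in hA *; rewrite [prefix_clauses _ _ _ _ _]/=.
  case: b IB => IB.
    have := IB _ _ _ acc (@budget_variable _ _ _ (tree_size (enc_formula B)) _ x _ hA).
    by move=> /(_ ltac:(lia)); lia.
  have := IB _ _ _ acc (@budget_skolem _ _ _ (tree_size (enc_formula B)) _ x _ hA).
  by move=> /(_ ltac:(lia)); lia.
- rewrite size_FEx in hA *; rewrite [prefix_clauses _ _ _ _ _]/=.
  case: b IB => IB.
    have := IB _ _ _ acc (@budget_skolem _ _ _ (tree_size (enc_formula B)) _ x _ hA).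
    by move=> /(_ ltac:(lia)); lia.
  have := IB _ _ _ acc (@budget_variable _ _ _ (tree_size (enc_formula B)) _ x _ hA).
  by move=> /(_ ltac:(lia)); lia.
Qed.

Variables (sat : bool) (N : nat).
Local Notation P := (clauses_program sat).
Local Notation U := (max_overhead P * N).

Definition prefix_step := U + value_step sat N.

Definition prefix_arg (b : bool) (s : osubst) (ys : seq oterm) (A : formula)
    (p : word) (acc : tree) : tree :=
  Cons (enc_bool b) (value_arg s ys A p acc).

Ltac matrix_call N hv sv hu :=
  by eapply (@callcost_traced _ N);
    [reflexivity | evaluate; [exact: hv | exact: sv] | reflexivity | exact: hu | lia].

(** Nodes of the prefix are charged [U] each. The matrices are disjoint subformulas, and each pays
    [U] once and [value_step] per unit of its size. *)
Lemma prefix_cost b s ys A p acc :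
  budget s ys (tree_size (enc_formula A)) p ->
  tree_size acc + tree_size (enc_formula A) * (2 * Q) <= N ->
  callcost P 6 (prefix_arg b s ys A p acc)
    (enc_onto (prefix_clauses b s ys A p) acc)
    (tree_size (enc_formula A) * prefix_step).
Proof.
have VS : value_step sat N <= prefix_step by rewrite /prefix_step; lia.
have US : U <= prefix_step by rewrite /prefix_step; lia.
have argN b' s' ys' A' p' acc' :
    budget s' ys' (tree_size (enc_formula A')) p' ->
    tree_size acc' + tree_size (enc_formula A') * (2 * Q) <= N ->
    tree_size (prefix_arg b' s' ys' A' p' acc') <= N.
  case/budgetW=> h1 h2 h3 hN; have A2 := formula_size_gt2 A'.
  have : 2 * Q <= tree_size (enc_formula A') * (2 * Q) by rewrite leq_pmull //; lia.
  by rewrite /prefix_arg /value_arg !size_Cons; case: (b') => /=; lia.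
have hmat s' ys' A' p' acc' :
    budget s' ys' (tree_size (enc_formula A')) p' ->
    tree_size acc' + tree_size (enc_formula A') * (2 * Q) <= N ->
    callcost P 5 (value_arg s' ys' A' p' acc')
      (enc_onto (value_clauses s' ys' A' p') acc')
      (tree_size (enc_formula A') * value_step sat N) /\
    tree_size (enc_onto (value_clauses s' ys' A' p') acc') <= N.
  case/budgetW=> h1 h2 h3 hN; split; first by apply: (value_cost MQ) => //; lia.
  by have := size_value_clauses MQ acc' h1 h2 h3; lia.
have hcost A' : U + tree_size (enc_formula A') * value_step sat N <=
    tree_size (enc_formula A') * prefix_step.
  have A2 := formula_size_gt2 A'; rewrite /prefix_step mulnDr leq_add2r leq_pmull //.
  by lia.
elim: A b s ys p acc => [q ts|||B IB C IC|B IB C IC|B IB C IC|B IB|x B IB|x B IB]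
  b s ys p acc hA hN; have hu := argN b _ _ _ _ _ hA hN;
  have [hv sv] := hmat _ _ _ _ _ hA hN.
- have h0 := hcost (FAtom q ts); case: b hu => hu.
  + matrix_call N hv sv hu.
  + matrix_call N hv sv hu.
- have h0 := hcost (FBot); case: b hu => hu.
  + matrix_call N hv sv hu.
  + matrix_call N hv sv hu.
- have h0 := hcost (FTop); case: b hu => hu.
  + matrix_call N hv sv hu.
  + matrix_call N hv sv hu.
- have h0 := hcost (FAnd B C).
  case: b hu => hu; last first.
    matrix_call N hv sv hu.
  rewrite size_FAnd in hA hN h0 *.
  have bC : budget s ys (tree_size (enc_formula C)) (true :: p).
    by apply: budget_child hA; lia.
  have bB : budget s ys (tree_size (enc_formula B)) (false :: p).
    by apply: budget_child hA; lia.
  have hC := size_prefix_clauses true acc bC.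
  have hB := size_prefix_clauses true
    (enc_onto (prefix_clauses true s ys C (true :: p)) acc) bB.
  eapply (@callcost_traced _ N); [reflexivity | evaluate | | exact: hu | ].
  + by apply: (IC _ _ _ (true :: p)) bC _; lia.
  + by lia.
  + by apply: (IB _ _ _ (false :: p)) bB _; lia.
  + by lia.
  + by rewrite [prefix_clauses _ _ _ _ _]/= enc_onto_cat.
  + by lia.
- have h0 := hcost (FOr B C); case: b hu => hu.
  + matrix_call N hv sv hu.
  + matrix_call N hv sv hu.
- have h0 := hcost (FImp B C); case: b hu => hu.
  + matrix_call N hv sv hu.
  + matrix_call N hv sv hu.
- have h0 := hcost (FDelta B); case: b hu => hu.
  + matrix_call N hv sv hu.
  + matrix_call N hv sv hu.
- have h0 := hcost (FAll x B); rewrite size_FAll in hA hN h0 *.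
  case: b hu => hu.
  {
    have bV := @budget_variable _ _ _ (tree_size (enc_formula B)) _ x _ hA.
    have {}bV := bV ltac:(lia).
    have hB := size_prefix_clauses true acc bV.
    eapply (@callcost_traced _ N); [reflexivity | evaluate | | exact: hu | ].
    + by apply: (IB _ _ _ (false :: p)) bV _; lia.
    + by lia.
    + by [].
    + by lia.
  }
    have bS := @budget_skolem _ _ _ (tree_size (enc_formula B)) _ x _ hA.
    have {}bS := bS ltac:(lia).
    have hB := size_prefix_clauses false acc bS.
    eapply (@callcost_traced _ N); [reflexivity | evaluate | | exact: hu | ].
    + by apply: (IB _ _ _ (false :: p)) bS _; lia.
    + by lia.
    + by [].
    + by lia.
- have h0 := hcost (FEx x B); rewrite size_FEx in hA hN h0 *.
  case: b hu => hu.
  {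
    have bS := @budget_skolem _ _ _ (tree_size (enc_formula B)) _ x _ hA.
    have {}bS := bS ltac:(lia).
    have hB := size_prefix_clauses true acc bS.
    eapply (@callcost_traced _ N); [reflexivity | evaluate | | exact: hu | ].
    + by apply: (IB _ _ _ (false :: p)) bS _; lia.
    + by lia.
    + by [].
    + by lia.
  }
    have bV := @budget_variable _ _ _ (tree_size (enc_formula B)) _ x _ hA.
    have {}bV := bV ltac:(lia).
    have hB := size_prefix_clauses false acc bV.
    eapply (@callcost_traced _ N); [reflexivity | evaluate | | exact: hu | ].
    + by apply: (IB _ _ _ (false :: p)) bV _; lia.
    + by lia.
    + by [].
    + by lia.
Qed.
End Prefix.

(** * Polynomial bounds and the running time of the whole program *)

Definition poly_bounded (f : nat -> nat) : Prop :=
  exists c k, forall n, 0 < n -> f n <= c * n ^ k.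

Lemma poly_bounded_cst c : poly_bounded (fun=> c).
Proof. by exists c, 0 => n _; rewrite expn0 muln1. Qed.

Lemma poly_bounded_id : poly_bounded id.
Proof. by exists 1, 1 => n _; rewrite mul1n expn1. Qed.

Lemma poly_bounded_add f g :
  poly_bounded f -> poly_bounded g -> poly_bounded (fun n => f n + g n).
Proof.
case=> c [k hf] [d [l hg]]; exists (c + d), (k + l) => n n0.
rewrite mulnDl; apply: leq_add.
  apply: leq_trans (hf n n0) _; rewrite leq_mul2l leq_pexp2l ?orbT //.
  exact: leq_addr.
apply: leq_trans (hg n n0) _; rewrite leq_mul2l leq_pexp2l ?orbT //.
exact: leq_addl.
Qed.

Lemma poly_bounded_mul f g :
  poly_bounded f -> poly_bounded g -> poly_bounded (fun n => f n * g n).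
Proof.
case=> c [k hf] [d [l hg]]; exists (c * d), (k + l) => n n0.
by rewrite expnD mulnACA leq_mul ?hf ?hg.
Qed.

Ltac prove_poly_bounded :=
  lazymatch goal with
  | |- poly_bounded (fun n => n) => exact poly_bounded_id
  | |- poly_bounded (fun _ => ?c) => exact (poly_bounded_cst c)
  | |- poly_bounded (fun n => @?f n + @?g n) =>
      refine (@poly_bounded_add f g _ _); cbv beta; prove_poly_bounded
  | |- poly_bounded (fun n => @?f n * @?g n) =>
      refine (@poly_bounded_mul f g _ _); cbv beta; prove_poly_bounded
  end.

(** These values of [M1], [M2] and [M3] make the initial arguments satisfy [budget]: the constants
    1, 20 and 1 bound the sizes of the empty path, the list holding only the threshold, and the
    empty substitution. *)
Definition budget1 n := 4 * n + 1.
Definition budget2 n := n * (budget1 n + 20) + 20.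
Definition budget3 n := n * (budget1 n + budget2 n + 40) + 1.
Definition clause_bound n := 20 * (budget1 n + budget2 n + budget3 n) + 600.
Definition tree_bound n := n * (2 * clause_bound n) + 1.

Definition main_cost (b : bool) n :=
  max_overhead (clauses_program b) * tree_bound n + n * prefix_step b (tree_bound n).

Lemma poly_bounded_main_cost b : poly_bounded (main_cost b).
Proof.
rewrite /main_cost /prefix_step /value_step /term_step /lookup_step /tree_bound
  /clause_bound /budget3 /budget2 /budget1.
by prove_poly_bounded.
Qed.

Definition main_clauses (b : bool) (A : formula) : oclauses :=
  if b then sat_clauses A else val_clauses A.

Lemma main_clauses_cost b A :
  callcost (clauses_program b) 0 (enc_formula A) (enc_oclauses (main_clauses b A))
    (main_cost b (tree_size (enc_formula A))).
Proof.
set a := tree_size _; have a2 : 2 < a := formula_size_gt2 A.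
have hA : budget (budget1 a) (budget2 a) (budget3 a) [::] [:: threshold b] a [::].
  split; rewrite /budget3 /budget2 /budget1 /=; try lia.
  by rewrite /threshold; case: b => /=; lia.
have h1 : budget1 a <= budget1 a + budget2 a + budget3 a by lia.
have h2 : budget2 a <= budget1 a + budget2 a + budget3 a by lia.
have h3 : budget3 a <= budget1 a + budget2 a + budget3 a by lia.
have hN : tree_size Nil + a * (2 * clause_bound a) <= tree_bound a.
  by rewrite /tree_bound addnC.
have aN : a <= tree_bound a.
  by apply: leq_trans hN; rewrite -addn1 /= /clause_bound; nia.
have hc := @prefix_cost _ _ _ _ _ h1 h2 h3 (leqnn _) b _ b _ _ A _ Nil hA hN.
have hs := leq_trans (@size_prefix_clauses _ _ _ _ _ h1 h2 h3 (leqnn _) b _ _ A _ Nil hA) hN.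
rewrite /main_cost /main_clauses; case: b hA hc hs => _ hc hs.
  by eapply (@callcost_traced _ (tree_bound a));
    [reflexivity | evaluate; [exact: hc | exact: hs] | reflexivity | exact: aN | lia].
by eapply (@callcost_traced _ (tree_bound a));
  [reflexivity | evaluate; [exact: hc | exact: hs] | reflexivity | exact: aN | lia].
Qed.

Lemma eval_size_le P env e v c : eval P env e v c -> tree_size v <= c.
Proof. by case=> *; rewrite ?leq_addl. Qed.

Lemma main_clauses_poly_time b (D : formula -> Prop) :
  poly_time_on enc_formula enc_oclauses D (main_clauses b).
Proof.
(* The outermost call is charged the size of its argument, the cost of its body, and the size of the
   result, which is again at most the cost of the body. *)
have [c [k hck]] : poly_bounded (fun n => n + main_cost b n + main_cost b n).
  have hT := poly_bounded_main_cost b.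
  exact: poly_bounded_add (poly_bounded_add poly_bounded_id hT) hT.
exists (clauses_program b), c, k => A _.
have [body [d [bodyE ev hd]]] := main_clauses_cost b A.
exists (tree_size (enc_formula A) + d + tree_size (enc_oclauses (main_clauses b A))).
  by apply: eval_call bodyE ev; exact: eval_var.
apply: leq_trans (hck _ (tree_size_gt0 _)); have := eval_size_le ev; lia.
Qed.

(** * From order models to interpretations *)

Import Order.TTheory GRing.Theory Num.Theory.

Section HerbrandUniverse.
Variable M : ostructure.
Hypothesis HM : dtoe_axioms M.

Definition midpoint (x y : ocar M) : ocar M :=
  match pselect (olt x y) with
  | left h => s2val (cid2 (olt_dense HM h))
  | right _ => obot M
  end.

Lemma midpointP x y : olt x y -> olt x (midpoint x y) /\ olt (midpoint x y) y.
Proof.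
by rewrite /midpoint; case: pselect => // h _; case: cid2.
Qed.

(* Ground terms over the symbols, bottom, top and a midpoint function; GenTree
   provides their countability. *)
Local Notation gterm := (GenTree.tree bool).

Definition symbol_code (s : osymbol) : nat :=
  pickle (Some (match s with OFun f => (false, f) | OPred p => (true, p) end)).

Definition midpoint_code : nat := pickle (None : option (bool * word)).

Fixpoint ground_val (t : gterm) : ocar M :=
  match t with
  | GenTree.Leaf b => if b then otop M else obot M
  | GenTree.Node n ts =>
      let ds := map ground_val ts in
      if (unpickle n : option (option (bool * word))) is Some (Some (b, w))
      then Defs.oapp (if b then OPred w else OFun w) ds
      else midpoint (nth (obot M) ds 0) (nth (obot M) ds 1)
  end.

Lemma ground_val_app s ts :
  ground_val (GenTree.Node (symbol_code s) ts) = Defs.oapp s (map ground_val ts).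
Proof.
by rewrite /ground_val -/ground_val /symbol_code pickleK; case: s.
Qed.

Lemma ground_val_mid s t :
  ground_val (GenTree.Node midpoint_code [:: s; t]) =
  midpoint (ground_val s) (ground_val t).
Proof. by rewrite /ground_val -/ground_val /midpoint_code pickleK. Qed.

Fixpoint ground_inst (e : word -> gterm) (t : oterm) : gterm :=
  match t with
  | OVar x => e x
  | OBot => GenTree.Leaf false
  | OTop => GenTree.Leaf true
  | OApp s ts => GenTree.Node (symbol_code s) (map (ground_inst e) ts)
  end.

Lemma ground_val_inst (e : word -> gterm) (t : oterm) :
  ground_val (ground_inst e t) = oterm_val (fun x => ground_val (e x)) t.
Proof.
elim/oterm_nested_ind: t => // s ts IH.
rewrite [ground_inst _ _]/= ground_val_app -map_comp /=.
by apply: (f_equal (Defs.oapp s)); exact: eq_map_Forall.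
Qed.

Definition ground_enum (i : nat) : ocar M :=
  if unpickle i is Some t then ground_val t else obot M.

Variable R : realType.
Local Open Scope ring_scope.
Local Open Scope classical_set_scope.

Definition weight (i : nat) : R := 2^-1 ^+ i.+1.

Definition rank_sum (x : ocar M) (n : nat) : R :=
  \sum_(i < n | `[< olt (ground_enum i) x >]) weight i.

(** The supremum of the bounded partial sums stands for the infinite sum of weights. *)
Definition rank (x : ocar M) : R := sup (range (rank_sum x)).

Lemma weight_gt0 i : 0 < weight i.
Proof. by rewrite exprn_gt0 // invr_gt0 ltr0n. Qed.

Lemma sum_weight n : \sum_(i < n) weight i = 1 - 2^-1 ^+ n.
Proof.
elim: n => [|n IH]; first by rewrite big_ord0 expr0 subrr.
rewrite big_ord_recr /= IH /weight exprS; lra.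
Qed.

Lemma rank_sum_le1 x n : rank_sum x n <= 1.
Proof.
apply: (@le_trans _ _ (\sum_(i < n) weight i)).
  rewrite /rank_sum [leRHS](bigID (fun i : 'I_n => `[< olt (ground_enum i) x >])) /=.
  rewrite lerDl; apply: sumr_ge0 => i _; exact/ltW/weight_gt0.
rewrite sum_weight gerBl exprn_ge0 // invr_ge0 ler0n //.
Qed.

Lemma rank_has_sup x : has_sup (range (rank_sum x)).
Proof.
split; first by exists (rank_sum x 0), 0%N.
by exists 1 => _ [n _ <-]; exact: rank_sum_le1.
Qed.

Lemma rank_sum_le x n : rank_sum x n <= rank x.
Proof. by apply: sup_upper_bound; [exact: rank_has_sup|exists n]. Qed.

Lemma rank_sum_homo x y n :
  (forall i, (i < n)%N -> olt (ground_enum i) x -> olt (ground_enum i) y) ->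
  rank_sum x n <= rank_sum y n.
Proof.
move=> xy; rewrite /rank_sum big_mkcond [leRHS]big_mkcond.
apply: ler_sum => i _; case: asboolP => [/xy h|_].
  by rewrite asboolT //; apply: h.
by case: ifP => // _; exact/ltW/weight_gt0.
Qed.

(** The index of [t] itself makes the inequality strict: its weight counts for [y], but not for
    [ground_val t], which is not below itself. *)
Lemma rank_lt t y : olt (ground_val t) y -> rank (ground_val t) < rank y.
Proof.
move=> ty; pose k := pickle t.
have ek : ground_enum k = ground_val t by rewrite /ground_enum pickleK.
apply: (@lt_le_trans _ _ (rank (ground_val t) + weight k)).
  by rewrite ltrDl weight_gt0.
rewrite -lerBrDr; apply: ge_sup; first by case: (rank_has_sup (ground_val t)).
move=> _ [n _ <-]; rewrite lerBrDr.
(* This length covers both the given partial sum and the index [k]. *)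
apply: le_trans (rank_sum_le y (maxn n k.+1)).
apply: (@le_trans _ _ (rank_sum (ground_val t) (maxn n k.+1) + weight k)).
  rewrite lerD2r /rank_sum.
  have H := leq_maxl n k.+1.
  rewrite (big_ord_widen_cond _ (fun i => `[< olt (ground_enum i) (ground_val t) >]) weight H).
  rewrite big_mkcondr; apply: ler_sum => i _; case: ifP => // _.
  exact/ltW/weight_gt0.
have kn : (k < maxn n k.+1)%N by rewrite leq_max leqnn orbT.
rewrite /rank_sum [leRHS](bigD1 (Ordinal kn)) /=; last by rewrite ek; apply/asboolP.
rewrite addrC; apply: lerD => //; rewrite big_mkcond [leRHS]big_mkcond.
apply: ler_sum => i _.
case: asboolP => [h|_].
  rewrite asboolT /=; last exact: olt_trans h ty.
  case: eqP => //= E; move: h; rewrite E /= ek => /(olt_irrefl HM) [].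
by case: ifP => // _; exact/ltW/weight_gt0.
Qed.

Lemma olt_bot x : ~ olt x (obot M).
Proof.
move=> h; case/(ole_refl_closure HM): (obot_le HM x) => [h'|e].
  exact: (olt_irrefl HM) (olt_trans HM h h').
by move: h; rewrite -e => /(olt_irrefl HM).
Qed.

Lemma rank_bot : rank (obot M) = 0.
Proof.
rewrite /rank; have -> : range (rank_sum (obot M)) = [set 0].
  apply/seteqP; split=> [_ [n _ <-]|_ ->] /=.
    by rewrite /rank_sum big1 // => i /asboolP /olt_bot.
  by exists 0%N => //; rewrite /rank_sum big_ord0.
exact: sup1.
Qed.

(** Finitely many elements below top lie strictly below one ground term that is still below top.
    When a new element is not already below the bound, the midpoint of that element and top becomes
    the new bound. *)
Lemma rank_sum_top_reached n :
  exists2 t, olt (ground_val t) (otop M) &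
    rank_sum (otop M) n <= rank (ground_val t).
Proof.
suff [t tT h] : exists2 t, olt (ground_val t) (otop M) & forall i, (i < n)%N ->
    olt (ground_enum i) (otop M) -> olt (ground_enum i) (ground_val t).
  by exists t => //; apply: le_trans (rank_sum_le _ n); exact: rank_sum_homo.
elim: n => [|n [t tT h]].
  by exists (GenTree.Leaf false) => //; exact: obot_lt_top HM.
have [nT|nT] := pselect (olt (ground_enum n) (otop M)); last first.
  by exists t => // i; rewrite ltnS leq_eqVlt => /orP[/eqP ->|/h].
have [s es] : exists s, ground_enum n = ground_val s.
  rewrite /ground_enum; case: unpickle => [s|]; first by exists s.
  by exists (GenTree.Leaf false).
pose m (a : gterm) := GenTree.Node midpoint_code [:: a; GenTree.Leaf true].
have mP a : olt (ground_val a) (otop M) ->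
    olt (ground_val a) (ground_val (m a)) /\ olt (ground_val (m a)) (otop M).
  by move=> aT; rewrite ground_val_mid; exact: midpointP.
have [u uT [tu nu]] : exists2 u, olt (ground_val u) (otop M) &
    (olt (ground_val t) (ground_val u) \/ ground_val t = ground_val u) /\
    olt (ground_enum n) (ground_val u).
  have [nt|nt|tn] := olt_total HM (ground_enum n) (ground_val t).
  - by exists t => //; split=> //; right.
  - by have [h1 h2] := mP t tT; exists (m t) => //; rewrite nt; split=> //; left.
  - have [] := mP s; rewrite -es // => h1 h2; exists (m s) => //; split=> //.
    by left; exact: olt_trans tn h1.
exists u => // i; rewrite ltnS leq_eqVlt => /orP[/eqP -> //|/h {}h] /h {}h.
by case: tu => [tu|<- //]; exact: olt_trans h tu.
Qed.

Definition truth_degree (t : gterm) : R := rank (ground_val t) / rank (otop M).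

Lemma rank_top_gt0 : 0 < rank (otop M).
Proof.
by rewrite -rank_bot; apply: (@rank_lt (GenTree.Leaf false)); exact: obot_lt_top.
Qed.

Lemma truth_degree_lt s t :
  truth_degree s < truth_degree t <-> olt (ground_val s) (ground_val t).
Proof.
rewrite /truth_degree ltr_pM2r ?invr_gt0 ?rank_top_gt0 //.
split=> [|/rank_lt //] h.
have [//|e|/rank_lt /(lt_trans h)] :=
  olt_total HM (ground_val s) (ground_val t); last by rewrite ltxx.
by move: h; rewrite e ltxx.
Qed.

Lemma truth_degree_le s t :
  truth_degree s <= truth_degree t <-> ole (ground_val s) (ground_val t).
Proof.
rewrite leNgt; split=> [/negP h|/(ole_refl_closure HM)].
  apply/(ole_refl_closure HM).
  case: (olt_total HM (ground_val s) (ground_val t)); [by left|by right|].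
  by move/truth_degree_lt.
case=> [/truth_degree_lt /ltW|e]; first by rewrite leNgt.
by rewrite /truth_degree e ltxx.
Qed.

Lemma truth_degree_bot : truth_degree (GenTree.Leaf false) = 0.
Proof. by rewrite /truth_degree /= rank_bot mul0r. Qed.

Lemma truth_degree_top : truth_degree (GenTree.Leaf true) = 1.
Proof. by rewrite /truth_degree /= divff // gt_eqF // rank_top_gt0. Qed.

Lemma truth_degree01 t : 0 <= truth_degree t <= 1.
Proof.
rewrite -truth_degree_bot -truth_degree_top; apply/andP.
by split; apply/truth_degree_le; [exact: obot_le|exact: ole_top].
Qed.

(** This is what the midpoint function is for: a formula whose value is at least every degree of a
    term below top must have value 1. *)
Lemma truth_degree_cofinal r : r < 1 ->
  exists2 t, olt (ground_val t) (otop M) & r < truth_degree t.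
Proof.
move=> r1; pose eps := (1 - r) * rank (otop M).
have e0 : 0 < eps by rewrite mulr_gt0 ?subr_gt0 ?rank_top_gt0.
have [_ [n _ <-]] := sup_adherent e0 (rank_has_sup (otop M)).
rewrite -/(rank _) => hn.
have [t tT nt] := rank_sum_top_reached n; exists t => //.
rewrite /truth_degree ltr_pdivlMr ?rank_top_gt0 //; apply: lt_le_trans nt.
by move: hn; rewrite /eps mulrBl mul1r opprB addrC subrK.
Qed.

End HerbrandUniverse.

(** * Values of formulas under varying environments *)

Section Valuations.
Variable R : realType.
Local Open Scope ring_scope.
Local Open Scope classical_set_scope.
Implicit Types (I : interp R) (A B : formula).

(** Changing only the environment keeps the type [dom I] fixed when quantifiers are entered. *)
Definition with_env I (r : word -> dom I) : interp R :=
  Interp r (@ifun R I) (@ipred01 R I).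

Lemma with_env_ivar I : with_env (@ivar R I) = I.
Proof. by case: I. Qed.

Definition fval I (r : word -> dom I) A : R := formula_val (with_env r) A.

Definition upd (D : Type) (r : word -> D) (x : word) (d : D) : word -> D :=
  fun y => if y == x then d else r y.

Lemma fval_all I (r : word -> dom I) x B :
  fval r (FAll x B) = inf (range (fun d => fval (upd r x d) B)).
Proof. by []. Qed.

Lemma fval_ex I (r : word -> dom I) x B :
  fval r (FEx x B) = sup (range (fun d => fval (upd r x d) B)).
Proof. by []. Qed.

Lemma range_neq0 I (f : dom I -> R) : range f !=set0.
Proof. by exists (f (ivar I [::])), (ivar I [::]). Qed.

Lemma formula_val01 I A : 0 <= formula_val I A <= 1.
Proof.
elim: A I => [p ts|||B IB C IC|B IB C IC|B IB C IC|B IB|x B IB|x B IB] I /=.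
- exact: ipred01.
- by rewrite lexx ler01.
- by rewrite lexx ler01.
- have /andP[b0 b1] := IB I; have /andP[c0 c1] := IC I.
  by rewrite le_min b0 c0 ge_min b1.
- have /andP[b0 b1] := IB I; have /andP[c0 c1] := IC I.
  by rewrite le_max b0 ge_max b1 c1.
- by case: ifP => _; rewrite ?ler01 ?lexx.
- by case: ifP => _; rewrite ?ler01 ?lexx.
- apply/andP; split.
    apply: lb_le_inf; first exact: range_neq0.
    by move=> _ [d _ <-]; case/andP: (IB (interp_upd x d)).
  apply: (@le_trans _ _ (formula_val (interp_upd x (ivar I [::])) B)).
    apply: ge_inf; last by exists (ivar I [::]).
    by exists 0 => _ [d _ <-]; case/andP: (IB (interp_upd x d)).
  by case/andP: (IB (interp_upd x (ivar I [::]))).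
- apply/andP; split.
    apply: (@le_trans _ _ (formula_val (interp_upd x (ivar I [::])) B)).
      by case/andP: (IB (interp_upd x (ivar I [::]))).
    apply: ub_le_sup; last by exists (ivar I [::]).
    by exists 1 => _ [d _ <-]; case/andP: (IB (interp_upd x d)).
  apply: ge_sup; first exact: range_neq0.
  by move=> _ [d _ <-]; case/andP: (IB (interp_upd x d)).
Qed.

Lemma fval01 I (r : word -> dom I) A : 0 <= fval r A <= 1.
Proof. exact: formula_val01. Qed.

Lemma fval_all_le I (r : word -> dom I) x B d :
  fval r (FAll x B) <= fval (upd r x d) B.
Proof.
rewrite fval_all; apply: ge_inf; last by exists d.
by exists 0 => _ [a _ <-]; case/andP: (fval01 (upd r x a) B).
Qed.

Lemma le_fval_all I (r : word -> dom I) x B v :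
  (forall d, v <= fval (upd r x d) B) -> v <= fval r (FAll x B).
Proof.
move=> h; rewrite fval_all; apply: lb_le_inf; first exact: range_neq0.
by move=> _ [d _ <-].
Qed.

Lemma fval_all_lt I (r : word -> dom I) x B v :
  fval r (FAll x B) < v -> exists d, fval (upd r x d) B < v.
Proof.
move=> h; apply/not_existsP => H; move: h; apply/negP; rewrite -leNgt.
by apply: le_fval_all => d; rewrite leNgt; apply/negP/H.
Qed.

Lemma fval_ex_ge I (r : word -> dom I) x B d :
  fval (upd r x d) B <= fval r (FEx x B).
Proof.
rewrite fval_ex; apply: ub_le_sup; last by exists d.
by exists 1 => _ [a _ <-]; case/andP: (fval01 (upd r x a) B).
Qed.

Lemma ge_fval_ex I (r : word -> dom I) x B v :
  (forall d, fval (upd r x d) B <= v) -> fval r (FEx x B) <= v.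
Proof.
move=> h; rewrite fval_ex; apply: ge_sup; first exact: range_neq0.
by move=> _ [d _ <-].
Qed.

Lemma lt_fval_ex I (r : word -> dom I) x B v :
  v < fval r (FEx x B) -> exists d, v < fval (upd r x d) B.
Proof.
move=> h; apply/not_existsP => H; move: h; apply/negP; rewrite -leNgt.
by apply: ge_fval_ex => d; rewrite leNgt; apply/negP/H.
Qed.

End Valuations.

(** * The Herbrand interpretation obtained from a model of the clauses *)

(** The formulas on which [prefix_clauses] ends at quantifier free matrices; with [sat] they include
    conjunctions of prenex formulas. *)
Fixpoint clausal_shape (sat : bool) (A : formula) : bool :=
  match A with
  | FAll _ B | FEx _ B => clausal_shape sat B
  | FAnd B C =>
      if sat then clausal_shape sat B && clausal_shape sat C
      else quantifier_free A
  | _ => quantifier_free A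
  end.

Lemma quantifier_free_clausal sat A : quantifier_free A -> clausal_shape sat A.
Proof.
elim: A => //= B IB C IC /andP[hB hC].
by case: sat IB IC => [IB IC|_ _]; rewrite ?hB ?hC // IB // IC.
Qed.

Lemma prenex_clausal sat A : prenex A -> clausal_shape sat A.
Proof.
case/andP=> + _; elim: A => //= B _ C _ h.
exact: (@quantifier_free_clausal sat (FAnd B C)).
Qed.

(** Freshness is measured by length: the variable introduced at [p] has length [size p + 1], so it
    differs from every variable in terms satisfying [fresh_in (size p)]. *)
Fixpoint fresh_in (n : nat) (t : oterm) : bool :=
  match t with
  | OVar x => size x <= n
  | OBot | OTop => true
  | OApp _ ts => all (fresh_in n) ts
  end%N.

Lemma fresh_in_leq m n t : m <= n -> fresh_in m t -> fresh_in n t.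
Proof.
move=> mn; elim/oterm_nested_ind: t => //= [x h|_ ts]; first exact: leq_trans mn.
by elim=> //= t ts' ht _ IH /andP[/ht -> /IH ->].
Qed.

Lemma all_fresh_leq m n (ts : seq oterm) :
  m <= n -> all (fresh_in m) ts -> all (fresh_in n) ts.
Proof. by move=> mn; apply: sub_all => t; exact: fresh_in_leq. Qed.

Section StructureToInterp.
Variables (M : ostructure) (HM : dtoe_axioms M) (R : realType).
Local Open Scope ring_scope.
Local Notation gterm := (GenTree.tree bool).
Local Notation deg := (truth_degree HM R).

(** A variable denotes the constant that [lookup] returns for it in the empty substitution, so
    [subst_env e [::]] is the environment of this interpretation. *)
Definition herbrand_interp : interp R :=
  @Interp R gterm
    (fun x => GenTree.Node (symbol_code (OFun [:: true, false & x])) [::])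
    (fun f ts => GenTree.Node (symbol_code (OFun [:: true, true & f])) ts)
    (fun p ts => deg (GenTree.Node (symbol_code (OPred (true :: p))) ts))
    (fun p ts => truth_degree01 HM R _).

Local Notation HI := herbrand_interp.

Definition literal_holds (e : word -> gterm) (l : oliteral) : bool :=
  match l with
  | OLt s t => deg (ground_inst e s) < deg (ground_inst e t)
  | OLe s t => deg (ground_inst e s) <= deg (ground_inst e t)
  end.

Definition clauses_hold (e : word -> gterm) (S : oclauses) : bool :=
  all (has (literal_holds e)) S.

(** [truth_degree] preserves and reflects both order relations, so truth in [M] can be read off
    degrees of ground instances. *)
Lemma clauses_holdP e S :
  List.Forall (@oclause_true M) S -> clauses_hold e S.
Proof.
elim=> //= C S' hC _ ->; rewrite andbT.
have := hC (fun x => ground_val HM (e x)).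
elim: C {hC S'} => [h|l C IH h]; first by inversion h.
inversion h; last by rewrite /= IH // orbT.
rewrite /=; apply/orP; left.
case: l H0 {H h} => s t /=; rewrite -!ground_val_inst.
  by move/(truth_degree_lt HM R).
by move/(truth_degree_le HM R).
Qed.

Definition subst_env (e : word -> gterm) (s : osubst) : word -> dom HI :=
  fun x => ground_inst e (lookup x s).

Lemma term_val_herbrand e s (t : term) :
  term_val (with_env (subst_env e s)) t = ground_inst e (trans_term s t).
Proof.
elim/term_nested_ind: t => // f ts IH; rewrite [LHS]/= [RHS]/= -map_comp.
by apply: (f_equal (GenTree.Node _)); exact: eq_map_Forall.
Qed.

Lemma map_term_val_herbrand e s (ts : seq term) :
  map (term_val (with_env (subst_env e s))) ts =
  map (ground_inst e) (map (trans_term s) ts).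
Proof.
by rewrite -map_comp; apply: eq_map => t /=; rewrite term_val_herbrand.
Qed.

(** With bottom at 0 and top at 1, the clauses of each connective force the value named at a node to
    be its truth function applied to the values named below. *)
Lemma value_clauses_sound e s ys A p :
  quantifier_free A -> clauses_hold e (value_clauses s ys A p) ->
  fval (subst_env e s) A = deg (ground_inst e (value_term p ys)).
Proof.
elim: A p => [q ts|||B IB C IC|B IB C IC|B IB C IC|B IB|x B IB|x B IB] p //.
- move=> _ /=; rewrite orbF andbT orbF => h.
  by rewrite /fval /= map_term_val_herbrand; apply/esym/le_anti.
- rewrite /clauses_hold /= orbF andbT (truth_degree_bot HM R) => _ h.
  apply/le_anti; rewrite h.
  by case/andP: (truth_degree01 HM R (ground_inst e (value_term p ys))) => -> _.
- rewrite /clauses_hold /= orbF andbT (truth_degree_top HM R) => _ h.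
  apply/le_anti; rewrite h.
  by case/andP: (truth_degree01 HM R (ground_inst e (value_term p ys))) => _ ->.
- case/andP=> qB qC; rewrite /clauses_hold /= all_cat -!/(clauses_hold _ _).
  rewrite !orbF => /and4P[h1 h2 h3 /andP[/IB-/(_ qB) eB /IC-/(_ qC) eC]].
  rewrite /fval /= -!/(fval _ _) eB eC; apply/le_anti.
  by rewrite ge_min h3 le_min h1 h2.
- case/andP=> qB qC; rewrite /clauses_hold /= all_cat -!/(clauses_hold _ _).
  rewrite !orbF => /and4P[h1 h2 h3 /andP[/IB-/(_ qB) eB /IC-/(_ qC) eC]].
  rewrite /fval /= -!/(fval _ _) eB eC; apply/le_anti.
  by rewrite le_max h3 ge_max h1 h2.
- case/andP=> qB qC; rewrite /clauses_hold /= all_cat -!/(clauses_hold _ _).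
  rewrite !orbF => /and4P[h1 h2 h3 /andP[/IB-/(_ qB) eB /IC-/(_ qC) eC]].
  rewrite /fval /= -!/(fval _ _) eB eC; move: h1 h2 h3.
  have /andP[_] := truth_degree01 HM R (ground_inst e (value_term p ys)).
  case: leP => //= _ v1 h1 h2 h3; apply/le_anti.
    by move: h1; rewrite (truth_degree_top HM R) v1 => ->.
  by rewrite h2 h3.
- move=> qB; rewrite /clauses_hold /= -!/(clauses_hold _ _).
  rewrite !orbF => /and3P[h1 h2 /IB-/(_ qB) eB].
  rewrite /fval /= -!/(fval _ _) eB; move: h1 h2.
  rewrite (truth_degree_top HM R) (truth_degree_bot HM R).
  have /andP[v0 v1] := truth_degree01 HM R (ground_inst e (value_term p ys)).
  have /andP[_] := truth_degree01 HM R (ground_inst e (value_term (false :: p) ys)).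
  rewrite le_eqVlt; case: eqP => [->|_] /=.
    by rewrite ltxx => _ /= h1 _; apply/le_anti; rewrite v1 h1.
  by move=> h _; rewrite leNgt h /= => h0; apply/le_anti; rewrite v0 h0.
Qed.

Definition fresh_subst n (s : osubst) := all (fresh_in n) (unzip2 s).

Lemma ground_inst_upd e v d n (t : oterm) :
  fresh_in n t -> (n < size v)%N -> ground_inst (upd e v d) t = ground_inst e t.
Proof.
elim/oterm_nested_ind: t => [x| | |f ts IH] //= ft nv.
  by rewrite /upd; case: eqP ft => // ->; rewrite leqNgt nv.
congr GenTree.Node; move: ft; elim: IH => //= t ts' ht _ IH /andP[ft fts].
by rewrite ht // IH.
Qed.

Lemma fresh_lookup n s x : fresh_subst n s -> fresh_in n (lookup x s).
Proof.
by elim: s => //= -[y t] s IH /andP[ft fs]; case: eqP => // _; exact: IH.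
Qed.

Lemma subst_env_var e s p x d :
  fresh_subst (size p) s ->
  upd (subst_env e s) x d =
  subst_env (upd e (true :: p) d) ((x, OVar (true :: p)) :: s).
Proof.
move=> fs; apply/funext => y; rewrite /subst_env /= {1}/upd.
case: eqP => [_|_] /=; first by rewrite /upd eqxx.
by rewrite (@ground_inst_upd _ _ _ (size p)) //; exact: fresh_lookup.
Qed.

Lemma subst_env_term e s t x :
  upd (subst_env e s) x (ground_inst e t) = subst_env e ((x, t) :: s).
Proof. by apply/funext => y; rewrite /subst_env /= {1}/upd; case: eqP. Qed.

(** Universal quantifiers are handled by varying [e] at the fresh variable, existential ones by
    evaluating the Skolem term. The conclusion is not strict because an infimum of values above the
    threshold may equal it. *)
Lemma prefix_clauses_sat_sound s ys A p e :
  clausal_shape true A -> fresh_subst (size p) s ->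
  all (fresh_in (size p)) ys ->
  List.Forall (@oclause_true M) (prefix_clauses true s ys A p) ->
  deg (e [::]) < 1 -> deg (e [::]) <= fval (subst_env e s) A.
Proof.
have mtx A' s' ys' p' e' : quantifier_free A' ->
    List.Forall (@oclause_true M) (matrix_clauses true s' ys' A' p') ->
    deg (e' [::]) < 1 -> deg (e' [::]) <= fval (subst_env e' s') A'.
  move=> qA /(clauses_holdP e'); rewrite /clauses_hold /= orbF.
  case/andP=> + /(value_clauses_sound qA) ->.
  by rewrite (truth_degree_top HM R) [1 <= _]leNgt => + h; rewrite h => /ltW.
elim: A s ys p e => [q ts|||B IB C IC|B IB C IC|B IB C IC|B IB|x B IB|x B IB]
    s ys p e /= sA fs fy; try exact: mtx.
- case/andP: sA => sB sC; rewrite List.Forall_app => -[hB hC] h.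
  have fs' := all_fresh_leq (leqnSn _) fs.
  have fy' := all_fresh_leq (leqnSn _) fy.
  rewrite /fval /= -!/(fval _ _) le_min.
  by rewrite (IB _ _ _ _ _ _ _ hB) ?(IC _ _ _ _ _ _ _ hC).
- move=> h e1; apply: le_fval_all => d; rewrite (subst_env_var _ _ _ fs).
  have fs' := all_fresh_leq (leqnSn _) fs.
  have fy' := all_fresh_leq (leqnSn _) fy.
  (* The threshold variable is the empty word, so updating [e] at a tagged path leaves it
     unchanged. *)
  rewrite -[e [::]]/(upd e (true :: p) d [::]).
  by apply: (IB _ _ _ _ _ _ _ h) => //=; rewrite /fresh_subst /= leqnn.
- move=> h e1; pose d : dom HI := ground_inst e (OApp (OFun (false :: p)) ys).
  apply: le_trans (fval_ex_ge (subst_env e s) x B d); rewrite /d.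
  have fs' := all_fresh_leq (leqnSn _) fs.
  have fy' := all_fresh_leq (leqnSn _) fy.
  rewrite subst_env_term; apply: (IB _ _ _ _ _ _ _ h) => //=.
  by rewrite /fresh_subst /= fy'.
Qed.

Lemma prefix_clauses_val_sound s ys A p e :
  clausal_shape false A -> fresh_subst (size p) s ->
  all (fresh_in (size p)) ys ->
  List.Forall (@oclause_true M) (prefix_clauses false s ys A p) ->
  fval (subst_env e s) A <= deg (ground_inst e (threshold false)).
Proof.
have mtx A' s' ys' p' e' : quantifier_free A' ->
    List.Forall (@oclause_true M) (matrix_clauses false s' ys' A' p') ->
    fval (subst_env e' s') A' <= deg (ground_inst e' (threshold false)).
  move=> qA /(clauses_holdP e'); rewrite /clauses_hold /= orbF.
  by case/andP=> + /(value_clauses_sound qA) ->; exact: ltW.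
elim: A s ys p e => [q ts|||B IB C IC|B IB C IC|B IB C IC|B IB|x B IB|x B IB]
    s ys p e /= sA fs fy; try exact: mtx.
- move=> h; pose d : dom HI := ground_inst e (OApp (OFun (false :: p)) ys).
  apply: le_trans (fval_all_le (subst_env e s) x B d) _; rewrite /d.
  have fs' := all_fresh_leq (leqnSn _) fs.
  have fy' := all_fresh_leq (leqnSn _) fy.
  rewrite subst_env_term; apply: (IB _ _ _ _ _ _ _ h) => //=.
  by rewrite /fresh_subst /= fy'.
- move=> h; apply: ge_fval_ex => d; rewrite (subst_env_var _ _ _ fs).
  have fs' := all_fresh_leq (leqnSn _) fs.
  have fy' := all_fresh_leq (leqnSn _) fy.
  rewrite -[leRHS]/(deg (ground_inst (upd e (true :: p) d) (threshold false))).
  by apply: (IB _ _ _ _ _ _ _ h) => //=; rewrite /fresh_subst /= leqnn.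
Qed.

Lemma herbrand_sat A : clausal_shape true A ->
  List.Forall (@oclause_true M) (sat_clauses A) -> formula_val HI A = 1.
Proof.
move=> sA hA; apply/le_anti; case/andP: (formula_val01 HI A) => _ -> /=.
rewrite leNgt; apply/negP => /(truth_degree_cofinal HM) [t tT].
apply/negP; rewrite -leNgt.
(* The constant environment gives the threshold the value of [t], chosen below top with degree above
   the value of [A]. *)
have := @prefix_clauses_sat_sound [::] [:: OVar [::]] A [::] (fun=> t) sA.
apply=> //.
by rewrite -(truth_degree_top HM R); apply/truth_degree_lt.
Qed.

Lemma herbrand_val A : clausal_shape false A ->
  List.Forall (@oclause_true M) (val_clauses A) -> formula_val HI A < 1.
Proof.
move=> sA; rewrite /val_clauses => h.
pose e : word -> gterm := fun=> GenTree.Leaf true.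
have := clauses_holdP e h; rewrite /clauses_hold /= orbF => /andP[c1 _].
inversion h; rewrite -(truth_degree_top HM R); apply: le_lt_trans c1.
have := @prefix_clauses_val_sound [::] [:: threshold false] A [::] e sA.
by apply.
Qed.

End StructureToInterp.

(** * From interpretations to order models *)

(** Order models are one-sorted, so the domain elements must be ordered too. A well-order serves:
    uniqueness of minima gives antisymmetry, and minima of sets of two and three elements give
    totality and transitivity. *)
Lemma strict_total_order_exists (D : Type) : exists prec : D -> D -> Prop,
  [/\ forall x, ~ prec x x,
      forall x y z, prec x y -> prec y z -> prec x z
    & forall x y, [\/ prec x y, x = y | prec y x]].
Proof.
have [le wo] := well_ordering_principle {classic D}.
have min (P : {classic D} -> Prop) : (exists x, P x) ->
    exists2 z, P z & forall x, P x -> le z x.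
  case=> x Px; have [|z [[Pz lbz] _]] := wo [pred x | `[< P x >]].
    by exists x; apply/asboolP.
  exists z; first by apply/asboolP.
  by move=> y Py; apply: lbz; apply/asboolP.
have anti x y : le x y -> le y x -> x = y.
  move=> xy yx; have refl a : le a a.
    by have [|z -> h] := min (fun b => b = a); [exists a|exact: h].
  have [|z [_ uz]] := wo (pred2 x y); first by exists x; rewrite inE eqxx.
  have mx : minimum_of le (pred2 x y) x.
    by split=> [|a]; rewrite !inE ?eqxx // => /orP[] /eqP ->.
  have my : minimum_of le (pred2 x y) y.
    by split=> [|a]; rewrite !inE ?eqxx ?orbT // => /orP[] /eqP ->.
  by rewrite -(uz x mx) -(uz y my).
have total x y : le x y \/ le y x.
  have [|z [-> h|-> h]] := min (fun a => a = x \/ a = y).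
  - by exists x; left.
  - by left; apply: h; right.
  - by right; apply: h; left.
have trans x y z : le x y -> le y z -> le x z.
  move=> xy yz; have [|a ha h] := min (fun a => [\/ a = x, a = y | a = z]).
    by exists x; apply: Or31.
  have hx := h x (Or31 _ _ erefl); have hy := h y (Or32 _ _ erefl).
  have hz := h z (Or33 _ _ erefl).
  case: ha hx hy hz => -> // hx hy hz; first by rewrite (anti _ _ xy hx).
  by rewrite -(anti _ _ yz hy).
exists (fun x y => le x y /\ x <> y); split=> [x [] //|x y z [xy nxy] [yz nyz]|x y].
  split; first exact: trans xy yz.
  by move=> xz; apply: nxy; apply: anti => //; rewrite xz.
have [-> |xy] := pselect (x = y); first exact: Or32.
case: (total x y) => h; [apply: Or31|apply: Or33]; split=> //.
by move=> yx; apply: xy.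
Qed.

Section InterpToStructure.
Variables (R : realType) (I : interp R) (sat : bool) (A0 : formula).
Local Open Scope ring_scope.
Local Notation D := (dom I).

Variable prec : D -> D -> Prop.
Hypothesis prec_irrefl : forall x, ~ prec x x.
Hypothesis prec_trans : forall x y z, prec x y -> prec y z -> prec x z.
Hypothesis prec_total : forall x y, [\/ prec x y, x = y | prec y x].

Local Notation unit_interval := {r : R | 0 <= r <= 1}.

(* The elements of the domain (times R, for density) lie between 0 and the
   positive degrees. *)
Inductive carrier := Degree of unit_interval | Element (d : D) (q : R).

Definition carrier_lt (x y : carrier) : Prop :=
  match x, y with
  | Degree a, Degree b => val a < val b
  | Degree a, Element _ _ => val a = 0
  | Element _ _, Degree b => 0 < val b
  | Element d q, Element d' q' => prec d d' \/ d = d' /\ q < q'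
  end.

Definition elem (x : carrier) : D :=
  if x is Element d _ then d else ivar I [::].

(* A domain element used as a threshold acts as 1/2, which lies above it. *)
Definition degree (x : carrier) : R :=
  if x is Degree a then val a else 2^-1.

Lemma zero01 : 0 <= (0 : R) <= 1. Proof. by rewrite lexx ler01. Qed.
Lemma one01 : 0 <= (1 : R) <= 1. Proof. by rewrite lexx ler01. Qed.

Definition Deg (r : R) (h : 0 <= r <= 1) : carrier := Degree (exist _ r h).

Variables (c : R) (c01 : 0 <= c <= 1).

Definition exceeds (u : R) (r : word -> D) (A : formula) : Prop :=
  if sat then u < fval r A else fval r A < u.

Definition witness (u : R) (r : word -> D) (x : word) (B : formula) : D :=
  if pselect (exists d, exceeds u (upd r x d) B) is left h then projT1 (cid h)
  else ivar I [::].

Lemma witnessP u r x B :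
  (exists d, exceeds u (upd r x d) B) -> exceeds u (upd r x (witness u r x B)) B.
Proof. by rewrite /witness; case: pselect => // h _; case: cid. Qed.

(** Follows a path from the root and rebuilds the environment at its end: variables kept in the
    clauses take their values from [ds], outermost first, and Skolemized ones take the witnesses met
    on the way. Thus the path in its name determines the meaning of a symbol. *)
Fixpoint walk (u : R) (A : formula) (r : word -> D) (p : word) (ds : seq D) :
    formula * (word -> D) :=
  if p is b :: p' then
    match A with
    | FAnd B C | FOr B C | FImp B C => walk u (if b then C else B) r p' ds
    | FDelta B => walk u B r p' ds
    | FAll x B =>
        if sat then walk u B (upd r x (head (ivar I [::]) ds)) p' (behead ds)
        else walk u B (upd r x (witness u r x B)) p' ds
    | FEx x B =>
        if sat then walk u B (upd r x (witness u r x B)) p' ds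
        else walk u B (upd r x (head (ivar I [::]) ds)) p' (behead ds)
    | _ => (A, r)
    end
  else (A, r).

(* Argument lists have the threshold last and the innermost variable first. *)
Definition arg_threshold (cs : seq carrier) : R :=
  degree (head (Deg zero01) (rev cs)).

Definition arg_elems (cs : seq carrier) : seq D := map elem (behead (rev cs)).

Definition node (p : word) (cs : seq carrier) : formula * (word -> D) :=
  walk (arg_threshold cs) A0 (@ivar R I) (rev p) (arg_elems cs).

(** A Skolem symbol carries the path of the body, so the quantifier itself is at [p]. Domain
    elements are returned with second coordinate 0, which [elem] forgets. *)
Definition carrier_app (s : osymbol) (cs : seq carrier) : carrier :=
  match s with
  | OFun [::] => Deg c01
  | OFun (false :: p) =>
      match node p cs with
      | (FAll x B, r) | (FEx x B, r) =>
          Element (witness (arg_threshold cs) r x B) 0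
      | _ => Deg zero01
      end
  | OFun [:: true] => Deg zero01
  | OFun [:: true, false & x] => Element (ivar I x) 0
  | OFun [:: true, true & f] => Element (ifun f (map elem cs)) 0
  | OPred [::] => Deg zero01
  | OPred (true :: q) => Deg (@ipred01 R I q (map elem cs))
  | OPred (false :: p) => let (A, r) := node p cs in Deg (fval01 r A)
  end.

Definition interp_structure : ostructure :=
  OStructure carrier_app (Deg zero01) (Deg one01) carrier_lt
    (fun x y => carrier_lt x y \/ x = y).

Local Notation M := interp_structure.

(** Pairs are ordered lexicographically and placed between 0 and the positive degrees. Since the
    second coordinate is unbounded in both directions, there are no gaps between different domain
    elements or next to degree 0. *)
Lemma interp_structure_dtoe : dtoe_axioms M.
Proof.
split=> /=.
- by case=> [a|d q] /=; [rewrite ltxx|case=> [/prec_irrefl|[_]] //; rewrite ltxx].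
- case=> [[a /= ha]|d q] [[b /= hb]|d' q'] [[z /= hz]|d'' q''] //=; try lra.
  + case=> [dd'|[-> qq']] [d'd''|[<- q'q'']]; try by left.
      by left; exact: prec_trans dd' d'd''.
    by right; split=> //; exact: lt_trans qq' q'q''.
- case=> [[a ha]|d q] [[b hb]|d' q'] /=.
  + case: (ltgtP a b) => h; [exact: Or31|exact: Or33|apply: Or32].
    by congr Degree; apply: val_inj.
  + have [e|a0] := eqVneq a 0; first exact: Or31.
    by apply: Or33; case/andP: ha => ha _; rewrite lt_neqAle eq_sym a0.
  + have [e|b0] := eqVneq b 0; first exact: Or33.
    by apply: Or31; case/andP: hb => hb _; rewrite lt_neqAle eq_sym b0.
  + have [h| <-|h] := prec_total d d'; [by apply: Or31; left| |by apply: Or33; left].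
    case: (ltgtP q q') => h; [by apply: Or31; right|by apply: Or33; right|].
    by apply: Or32; rewrite h.
- case=> [[a /= ha]|d q] [[b /= hb]|d' q'] /= h.
  + have hm : 0 <= (a + b) / 2 <= 1 by lra.
    by exists (Deg hm) => /=; lra.
  + by exists (Element d' (q' - 1)) => //=; right; split=> //; lra.
  + have hm : 0 <= b / 2 <= 1 by lra.
    by exists (Deg hm) => /=; lra.
  + case: h => [h|[<- h]].
      by exists (Element d (q + 1)) => /=; [right; split=> //; lra|left].
    by exists (Element d ((q + q') / 2)) => /=; right; split=> //; lra.
- by [].
- case=> [[a ha]|d q] /=; last by left.
  have [a0|a0] := eqVneq a 0; last first.
    by left; case/andP: ha => ha _; rewrite lt_neqAle eq_sym a0.
  by right; congr Degree; apply: val_inj.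
- case=> [[a ha]|d q] /=; last by left; exact: ltr01.
  have [a1|a1] := eqVneq a 1; last first.
    by left; case/andP: ha => _ ha; rewrite lt_neqAle a1.
  by right; congr Degree; apply: val_inj.
- exact: ltr01.
Qed.

(** * Truth of the clauses in the constructed model *)

Lemma ole_degree a b (ha : 0 <= a <= 1) (hb : 0 <= b <= 1) :
  a <= b -> @ole M (Deg ha) (Deg hb).
Proof.
rewrite le_eqVlt => /predU1P[e|]; last by left.
by right; congr Degree; apply: val_inj.
Qed.

Definition elem_env (e : word -> carrier) (s : osubst) : word -> D :=
  fun x => elem (@oterm_val M e (lookup x s)).

Definition clauses_true (e : word -> carrier) (S : oclauses) : Prop :=
  List.Forall (List.Exists (@oliteral_true M e)) S.

Lemma elem_trans_term e s t :
  elem (@oterm_val M e (trans_term s t)) = term_val (with_env (elem_env e s)) t.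
Proof.
elim/term_nested_ind: t => // f ts IH /=; congr ifun.
by rewrite -!map_comp; exact: eq_map_Forall.
Qed.

Lemma elem_env_cons e s x t :
  elem_env e ((x, t) :: s) = upd (elem_env e s) x (elem (@oterm_val M e t)).
Proof. by apply/funext => y; rewrite /elem_env /upd /=; case: eqP. Qed.

(* The walk to the node p, whose subformula is A, consumes exactly the elements
   denoted by ys. *)
Definition at_node (e : word -> carrier) (s : osubst) (ys : seq oterm)
    (A : formula) (p : word) : Prop :=
  forall q ds,
    walk (arg_threshold (map (@oterm_val M e) ys)) A0 (@ivar R I) (rev p ++ q)
      (arg_elems (map (@oterm_val M e) ys) ++ ds) =
    walk (arg_threshold (map (@oterm_val M e) ys)) A (elem_env e s) q ds.

Lemma node_at e s ys A p : at_node e s ys A p ->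
  node p (map (@oterm_val M e) ys) = (A, elem_env e s).
Proof.
by move=> h; rewrite /node; have := h [::] [::]; rewrite !cats0 => ->; case: A {h}.
Qed.

Lemma value_term_at e s ys A p : at_node e s ys A p ->
  @oterm_val M e (value_term p ys) = Deg (fval01 (elem_env e s) A).
Proof. by move=> /node_at h /=; rewrite h. Qed.

Lemma at_node_child e s ys A B p b :
  (forall u r q ds, walk u A r (b :: q) ds = walk u B r q ds) ->
  at_node e s ys A p -> at_node e s ys B (b :: p).
Proof. by move=> AB h q ds; rewrite rev_cons cat_rcons h AB. Qed.

Lemma OLe_true e (s t : oterm) a b (ha : 0 <= a <= 1) (hb : 0 <= b <= 1) :
  @oterm_val M e s = Deg ha -> @oterm_val M e t = Deg hb -> a <= b ->
  @oliteral_true M e (OLe s t).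
Proof. by move=> /= -> ->; exact: ole_degree. Qed.

Lemma OLt_true e (s t : oterm) a b (ha : 0 <= a <= 1) (hb : 0 <= b <= 1) :
  @oterm_val M e s = Deg ha -> @oterm_val M e t = Deg hb -> a < b ->
  @oliteral_true M e (OLt s t).
Proof. by move=> /= -> ->. Qed.

(** By [value_term_at] each value symbol denotes the actual value of its subformula, so every clause
    is an instance of a law of the truth functions. *)
Lemma value_clauses_true e s ys A p :
  quantifier_free A -> at_node e s ys A p ->
  clauses_true e (value_clauses s ys A p).
Proof.
have hd := @List.Exists_cons_hd _ (@oliteral_true M e).
have tl := @List.Exists_cons_tl _ (@oliteral_true M e).
have nil := @List.Forall_nil _ (List.Exists (@oliteral_true M e)).
have cons := @List.Forall_cons _ (List.Exists (@oliteral_true M e)).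
have cat S S' : clauses_true e S -> clauses_true e S' -> clauses_true e (S ++ S').
  by move=> h h'; apply/List.Forall_app.
have bot : @oterm_val M e OBot = Deg zero01 by [].
have top : @oterm_val M e OTop = Deg one01 by [].
elim: A p => [q ts|||B IB C IC|B IB C IC|B IB C IC|B IB|x B IB|x B IB] p //.
- move=> _ /value_term_at h.
  have E : @oterm_val M e (OApp (OPred (true :: q)) (map (trans_term s) ts)) =
      Deg (fval01 (elem_env e s) (FAtom q ts)).
    rewrite /= /Deg; congr Degree; apply: val_inj => /=; congr ipred.
    by rewrite -!map_comp; apply: eq_map => t /=; rewrite elem_trans_term.
  apply: (cons); first by apply: hd; apply: OLe_true h E _.
  by apply: (cons) => //; apply: hd; apply: OLe_true E h _.
- move=> _ /value_term_at h; apply: (cons) => //; apply: hd.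
  by apply: OLe_true h bot _.
- move=> _ /value_term_at h; apply: (cons) => //; apply: hd.
  by apply: OLe_true top h _.
- case/andP=> qB qC aA.
  have aB : at_node e s ys B (false :: p) by exact: at_node_child aA.
  have aC : at_node e s ys C (true :: p) by exact: at_node_child aA.
  have h := value_term_at aA; have hB := value_term_at aB; have hC := value_term_at aC.
  apply: (cat); last by apply: (cat); [exact: IB|exact: IC].
  apply: (cons); first by apply: hd; apply: OLe_true h hB _; rewrite ge_min lexx.
  apply: (cons); first by apply: hd; apply: OLe_true h hC _; rewrite ge_min lexx orbT.
  apply: (cons) => //.
  have : (fval (elem_env e s) B <= fval (elem_env e s) (FAnd B C)) ||
         (fval (elem_env e s) C <= fval (elem_env e s) (FAnd B C)).
    by rewrite !le_min !lexx andbT /= le_total.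
  by case/orP=> l; [apply: hd; exact: OLe_true hB h l|apply: tl; apply: hd; exact: OLe_true hC h l].
- case/andP=> qB qC aA.
  have aB : at_node e s ys B (false :: p) by exact: at_node_child aA.
  have aC : at_node e s ys C (true :: p) by exact: at_node_child aA.
  have h := value_term_at aA; have hB := value_term_at aB; have hC := value_term_at aC.
  apply: (cat); last by apply: (cat); [exact: IB|exact: IC].
  apply: (cons); first by apply: hd; apply: OLe_true hB h _; rewrite le_max lexx.
  apply: (cons); first by apply: hd; apply: OLe_true hC h _; rewrite le_max lexx orbT.
  apply: (cons) => //.
  have : (fval (elem_env e s) (FOr B C) <= fval (elem_env e s) B) ||
         (fval (elem_env e s) (FOr B C) <= fval (elem_env e s) C).
    by rewrite !ge_max !lexx andbT /= le_total.
  by case/orP=> l; [apply: hd; exact: OLe_true h hB l|apply: tl; apply: hd; exact: OLe_true h hC l].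
- case/andP=> qB qC aA.
  have aB : at_node e s ys B (false :: p) by exact: at_node_child aA.
  have aC : at_node e s ys C (true :: p) by exact: at_node_child aA.
  have h := value_term_at aA; have hB := value_term_at aB; have hC := value_term_at aC.
  have E : fval (elem_env e s) (FImp B C) =
    if fval (elem_env e s) B <= fval (elem_env e s) C then 1 else fval (elem_env e s) C.
    by [].
  apply: (cat); last by apply: (cat); [exact: IB|exact: IC].
  apply: (cons).
    have [l|l] := leP (fval (elem_env e s) B) (fval (elem_env e s) C).
      by apply: tl; apply: hd; apply: OLe_true top h _; rewrite E l.
    by apply: hd; exact: OLt_true hC hB l.
  apply: (cons).
    have [l|l] := leP (fval (elem_env e s) B) (fval (elem_env e s) C).
      by apply: hd; exact: OLe_true hB hC l.
    by apply: tl; apply: hd; apply: OLe_true h hC _; rewrite E ifN -?ltNge.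
  apply: (cons) => //; apply: hd; apply: OLe_true hC h _; rewrite E.
  by case: ifP => // _; case/andP: (fval01 (elem_env e s) C).
- move=> qB aA.
  have aB : at_node e s ys B (false :: p) by exact: at_node_child aA.
  have h := value_term_at aA; have hB := value_term_at aB.
  have E : fval (elem_env e s) (FDelta B) =
    if fval (elem_env e s) B == 1 then 1 else 0 by [].
  have /andP[_] := fval01 (elem_env e s) B.
  move=> B1; rewrite [value_clauses _ _ _ _]/=.
  apply: (cons); last apply: (cons); last exact: IB.
    have [l|l] := eqVneq (fval (elem_env e s) B) 1.
      by apply: tl; apply: hd; apply: OLe_true top h _; rewrite E l eqxx.
    by apply: hd; apply: OLt_true hB top _; rewrite lt_neqAle l B1.
  have [l|l] := eqVneq (fval (elem_env e s) B) 1.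
    by apply: hd; apply: OLe_true top hB _; rewrite l.
  by apply: tl; apply: hd; apply: OLe_true h bot _; rewrite E (negbTE l).
Qed.

(** The invariant passed down the prefix: either the threshold is top and the first literal of the
    satisfiability clause holds, or the strict comparison does. *)
Definition below_threshold (e : word -> carrier) (A : formula) (r : word -> D) :=
  (sat /\ @oliteral_true M e (OLe OTop (threshold sat))) \/
  exceeds (degree (@oterm_val M e (threshold sat))) r A.

Definition threshold_last (ys : seq oterm) : Prop :=
  exists zs, ys = rcons zs (threshold sat).

Lemma arg_threshold_last e ys : threshold_last ys ->
  arg_threshold (map (@oterm_val M e) ys) = degree (@oterm_val M e (threshold sat)).
Proof. by case=> zs ->; rewrite /arg_threshold map_rcons rev_rcons. Qed.

(** The new variable heads [ys]; after reversal it is the last element, which the walk reads at its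
    last step. *)
Lemma at_node_variable e s ys A B p x v :
  threshold_last ys ->
  (forall u r q d ds, walk u A r (false :: q) (d :: ds) = walk u B (upd r x d) q ds) ->
  at_node e s ys A p ->
  at_node e ((x, OVar v) :: s) (OVar v :: ys) B (false :: p).
Proof.
case=> zs -> AB h q ds; move: h; rewrite /at_node /arg_threshold /arg_elems /=.
rewrite rev_cons map_rcons !rev_rcons /= map_rcons !cat_rcons rev_cons cat_rcons => h.
by rewrite h AB elem_env_cons.
Qed.

(** The walk and the interpretation of the Skolem term choose the same witness, because the latter
    is computed by the walk to [p]. *)
Lemma at_node_skolem e s ys A B p x :
  A = FAll x B \/ A = FEx x B ->
  (forall u r q ds,
    walk u A r (false :: q) ds = walk u B (upd r x (witness u r x B)) q ds) ->
  at_node e s ys A p ->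
  at_node e ((x, OApp (OFun (false :: p)) ys) :: s) ys B (false :: p).
Proof.
move=> hA AB h q ds; rewrite rev_cons cat_rcons h AB elem_env_cons.
by have := node_at h => /= ->; case: hA => ->.
Qed.

Lemma skolem_elem e s ys A B p x :
  A = FAll x B \/ A = FEx x B -> threshold_last ys -> at_node e s ys A p ->
  elem (@oterm_val M e (OApp (OFun (false :: p)) ys)) =
  witness (degree (@oterm_val M e (threshold sat))) (elem_env e s) x B.
Proof.
move=> hA /(arg_threshold_last e) <- /node_at /= ->.
by case: hA => ->.
Qed.

Lemma below_threshold_imp e A B r r' :
  (forall u, exceeds u r A -> exceeds u r' B) ->
  below_threshold e A r -> below_threshold e B r'.
Proof. by move=> AB [h|/AB h]; [left|right]. Qed.

Lemma satP : sat \/ ~~ sat.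
Proof. by apply/orP; rewrite orbN. Qed.

Lemma matrix_clauses_true e s ys A p :
  quantifier_free A -> at_node e s ys A p ->
  below_threshold e A (elem_env e s) ->
  clauses_true e (matrix_clauses sat s ys A p).
Proof.
move=> qA aA hA; apply: List.Forall_cons; last exact: value_clauses_true.
have hV := value_term_at aA.
have [h|h] := satP; last first.
  rewrite ifN //; apply: List.Exists_cons_hd.
  case: hA => [[h']|]; first by rewrite h' in h.
  have E : @oterm_val M e (threshold sat) = Deg c01 by rewrite /threshold ifN.
  by rewrite /exceeds ifN // E => l; exact: OLt_true hV E l.
rewrite ifT //; case: hA => [[_ hl]|]; first by apply: List.Exists_cons_hd; exact: hl.
rewrite /exceeds ifT // => l; apply: List.Exists_cons_tl; apply: List.Exists_cons_hd.
rewrite /oliteral_true hV; move: l.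
(* A domain element used as threshold counts as 1/2, so the value is above 1/2; it is then positive
   and exceeds the element in the model. *)
case: (@oterm_val M e (threshold sat) : carrier) => //= d q; apply: lt_trans.
by rewrite invr_gt0 ltr0n.
Qed.

(** Strictness makes Skolemization possible: a supremum above the threshold has a member above it,
    and an infimum below has a member below it. The alternative that the threshold is top passes to
    every subformula unchanged. *)
Lemma prefix_clauses_true e s ys A p :
  clausal_shape sat A -> threshold_last ys -> at_node e s ys A p ->
  below_threshold e A (elem_env e s) ->
  clauses_true e (prefix_clauses sat s ys A p).
Proof.
have last y ys' : threshold_last ys' -> threshold_last (y :: ys').
  by case=> zs ->; exists (y :: zs).
elim: A s ys p => [q ts|||B IB C IC|B IB C IC|B IB C IC|B IB|x B IB|x B IB]
    s ys p sA hy aA hA; try exact: matrix_clauses_true.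
- have [h|h] := satP; last first.
    rewrite [prefix_clauses _ _ _ _ _]/= ifN //; apply: matrix_clauses_true => //.
    by move: sA; rewrite /= ifN.
  move: sA; rewrite [clausal_shape _ _]/= ifT // => /andP[sB sC].
  rewrite [prefix_clauses _ _ _ _ _]/= ifT //; apply/List.Forall_app; split.
    apply: IB => //; first exact: at_node_child aA.
    apply: below_threshold_imp hA => u; rewrite /exceeds !ifT //.
    by rewrite lt_min => /andP[].
  apply: IC => //; first exact: at_node_child aA.
  apply: below_threshold_imp hA => u; rewrite /exceeds !ifT //.
  by rewrite lt_min => /andP[].
- have [h|h] := satP; rewrite [prefix_clauses _ _ _ _ _]/=; last first.
    rewrite ifN //; apply: IB => //.
      by apply: at_node_skolem aA; [left|move=> u r q ds /=; rewrite ifN].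
    rewrite elem_env_cons (skolem_elem (or_introl erefl) hy aA).
    case: hA => [[h']|hA]; [by rewrite h' in h|right].
    apply: witnessP; move: hA; rewrite /exceeds ifN // => /fval_all_lt [d hd].
    by exists d; rewrite ifN.
  rewrite ifT //; apply: IB => //; first exact: last.
    by apply: at_node_variable aA => // u r q d ds /=; rewrite ifT.
  rewrite elem_env_cons; apply: below_threshold_imp hA => u; rewrite /exceeds !ifT //.
  by move=> l; apply: lt_le_trans l _; exact: fval_all_le.
- have [h|h] := satP; rewrite [prefix_clauses _ _ _ _ _]/=.
    rewrite ifT //; apply: IB => //.
      by apply: at_node_skolem aA; [right|move=> u r q ds /=; rewrite ifT].
    rewrite elem_env_cons (skolem_elem (or_intror erefl) hy aA).
    case: hA => [hA|hA]; [by left|right].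
    apply: witnessP; move: hA; rewrite /exceeds ifT // => /lt_fval_ex [d hd].
    by exists d; rewrite ifT.
  rewrite ifN //; apply: IB => //; first exact: last.
    by apply: at_node_variable aA => // u r q d ds /=; rewrite ifN.
  rewrite elem_env_cons; apply: below_threshold_imp hA => u; rewrite /exceeds !ifN //.
  by apply: le_lt_trans; exact: fval_ex_ge.
Qed.

Lemma root_clauses_true e :
  clausal_shape sat A0 -> below_threshold e A0 (elem_env e [::]) ->
  clauses_true e (prefix_clauses sat [::] [:: threshold sat] A0 [::]).
Proof. by move=> sA; apply: prefix_clauses_true => //; exists [::]. Qed.

End InterpToStructure.

(** * Correctness of both clause sets and the final theorem *)

Lemma Forall_oclause_true (M : ostructure) S :
  (forall e, List.Forall (List.Exists (@oliteral_true M e)) S) ->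
  List.Forall (@oclause_true M) S.
Proof.
move=> h; apply/List.Forall_forall => C CS e.
by have /List.Forall_forall := h e; exact.
Qed.

Lemma sat_clauses_correct (R : realType) A : clausal_shape true A ->
  one_satisfiable R A <-> dtoe_satisfiable (sat_clauses A).
Proof.
move=> sA; split=> [[I IA]|[M [HM hM]]]; last first.
  by exists (herbrand_interp HM R); exact: herbrand_sat.
have [prec [p1 p2 p3]] := strict_total_order_exists (dom I).
pose M := interp_structure true A prec (zero01 R).
exists M; split; first exact: interp_structure_dtoe.
apply: Forall_oclause_true => e; apply: root_clauses_true => //.
have vA : fval (elem_env true A prec (zero01 R) e [::]) A = 1%R.
  by rewrite -IA /fval with_env_ivar.
rewrite /below_threshold /exceeds vA /=.
(* The value of [A] is 1, hence above every threshold of degree less than 1, including domain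
   elements with degree 1/2; a threshold of degree 1 is top. *)
case: (e [::]) => [[a ha]|d q] /=; last by right; rewrite invf_lt1 ?ltr1n.
have /andP[_ ha1] := ha.
have [a1|a1] := eqVneq a 1%R; last by right; rewrite lt_neqAle a1.
by left; split=> //; right; congr Degree; apply: val_inj.
Qed.

Lemma val_clauses_correct (R : realType) A : clausal_shape false A ->
  valid R A <-> dtoe_unsatisfiable (val_clauses A).
Proof.
move=> sA; split=> [vA [M [HM hM]]|h I].
  by have := herbrand_val HM R sA hM; rewrite (vA (herbrand_interp HM R)) ltxx.
apply/le_anti; case/andP: (formula_val01 I A) => A_ge0 -> /=.
rewrite leNgt; apply/negP => A1; apply: h.
have [prec [p1 p2 p3]] := strict_total_order_exists (dom I).
(* The constant is the midpoint of the value of [A] and 1, strictly between them. *)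
have c01 : (0 <= (formula_val I A + 1) / 2 <= 1)%R by lra.
pose M := interp_structure false A prec c01.
exists M; split; first exact: interp_structure_dtoe.
apply: Forall_oclause_true => e; apply: List.Forall_cons.
  by apply: List.Exists_cons_hd => /=; lra.
apply: root_clauses_true => //; right; rewrite /exceeds /=.
have -> : fval (elem_env false A prec c01 e [::]) A = formula_val I A.
  by rewrite /fval with_env_ivar.
lra.
Qed.

(** A minimum is 1 iff both arguments are, so validity splits into conjuncts. Satisfiability needs
    one interpretation for all of them, which is why [sat_clauses] takes the whole conjunction. *)
Lemma valid_big_and (R : realType) (As : seq formula) :
  valid R (big_and As) <-> forall A, List.In A As -> valid R A.
Proof.
elim: As => [|A [|B As] IH] /=.
- by split=> // _ I.
- by split=> [h _ [<-|//] |h I]; [exact: h|apply: h; left].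
have andE : valid R (FAnd A (big_and (B :: As))) <->
    valid R A /\ valid R (big_and (B :: As)).
  split=> [h|[hA hB] I].
    have le1 (I : interp R) :
        (1 <= Num.min (formula_val I A) (formula_val I (big_and (B :: As))))%R.
      by rewrite -[leLHS](h I).
    split=> I; apply/le_anti; have := le1 I; rewrite le_min => /andP[h1 h2].
      by rewrite h1; case/andP: (formula_val01 I A) => _ ->.
    by rewrite h2; case/andP: (formula_val01 I (big_and (B :: As))) => _ ->.
  by rewrite /= hA -[Num.min _ _]/(Num.min 1%R (formula_val I (big_and (B :: As)))) hB minxx.
split=> [/andE [hA /IH hB] C [<- //|CB]|h]; first exact: hB.
by apply/andE; split; [apply: h; left|apply/IH => C CB; apply: h; right].
Qed.

Lemma big_and_clausal As : all prenex As -> clausal_shape true (big_and As).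
Proof.
elim: As => [|A [|B As] IH] //= /andP[pA pAs]; first exact: prenex_clausal.
by rewrite prenex_clausal //= IH.
Qed.

Theorem theorem4p12 :
  exists (CSsat CSval : formula -> oclauses),
    [/\ poly_time_on enc_formula enc_oclauses prenex_conjunction CSsat,
        poly_time_on enc_formula enc_oclauses prenex CSval
      & forall (R : realType) (m : nat) (As : 'I_m -> formula),
          (forall i : 'I_m, prenex (As i)) ->
          let A := big_and (map As (enum 'I_m)) in
          (one_satisfiable R A <-> dtoe_satisfiable (CSsat A)) /\
          (valid R A <-> forall i : 'I_m, dtoe_unsatisfiable (CSval (As i)))].
Proof.
exists sat_clauses, val_clauses; split.
- exact: (main_clauses_poly_time true).
- exact: (main_clauses_poly_time false).
move=> R m As pAs A; split.
  apply: sat_clauses_correct; apply: big_and_clausal.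
  by rewrite all_map; apply/allP => i _; exact: pAs.
have vP i : valid R (As i) <-> dtoe_unsatisfiable (val_clauses (As i)).
  by apply: val_clauses_correct; exact: prenex_clausal.
split=> [/valid_big_and h i|h].
  apply/vP/h; have := mem_enum 'I_m i; elim: (enum _) => //= j s IH.
  by rewrite inE => /predU1P[->|/IH]; [left|right].
apply/valid_big_and => B; elim: (enum _) => //= j s IH [<-|/IH //].
by apply/vP/h.
Qed.
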